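(* Let $(\Omega,\Sigma)$ be a measurable space, let $E$ be a (real) Banach lattice and let $\nu:\Sigma\to E$ be a countably additive measure. If $\nu$ is non-atomic and its range $\mathcal{R}(\nu):=\{\nu(A): A\in\Sigma\}$ is a relatively norm compact subset of $E^+:=\{x\in E: x\geq 0\}$ (in particular $\mathcal{R}(\nu)\subseteq E^+$), then the Banach space $L_1(\nu)$ is weakly almost square (WASQ).
   Context: All Banach spaces are real. For a Banach space $X$, $B_X$ and $S_X$ denote its closed unit ball and unit sphere. WASQ: a Banach space $X$ is weakly almost square (WASQ) if for every $x\in S_X$ there is a weakly null sequence $(y_n)_{n\in\mathbb{N}}$ in $B_X$ such that $\|x+y_n\|\to 1$, $\|x-y_n\|\to 1$ and $\|y_n\|\to 1$. Vector measures: $(\Omega,\Sigma)$ is a set with a $\sigma$-algebra. Let $\nu:\Sigma\to X$ be a countably additive measure with values in a Banach space $X$. A set $A\in\Sigma$ is $\nu$-null if $\nu(B)=0$ for all $B\in\Sigma$ with $B\subseteq A$; $\mathcal{N}(\nu)$ is the family of $\nu$-null sets. A set $A\in\Sigma\setminus\mathcal{N}(\nu)$ is an atom of $\nu$ if for every $B\in\Sigma$ with $B\subseteq A$ either $B\in\mathcal{N}(\nu)$ or $A\setminus B\in\mathcal{N}(\nu)$; $\nu$ is non-atomic if it has no atoms. The space $L_1(\nu)$: a $\Sigma$-measurable $f:\Omega\to\mathbb{R}$ is $\nu$-integrable if $f\in L_1(|x^*\circ\nu|)$ for all $x^*\in X^*$ (where $|x^*\circ\nu|$ is the variation of the signed measure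 $x^*\circ\nu$) and for each $A\in\Sigma$ there is $\int_A f\,d\nu\in X$ with $x^*(\int_A f\,d\nu)=\int_A f\,d(x^*\circ\nu)$ for all $x^*\in X^*$. $L_1(\nu)$ is the space of $\nu$-integrable functions, identified when they coincide outside a $\nu$-null set, with norm $\|f\|_{L_1(\nu)}:=\sup_{x^*\in B_{X^*}}\int_\Omega|f|\,d|x^*\circ\nu|$; it is a Banach lattice with the $\nu$-a.e. order. *)

(* Defs.v *)
From HB Require Import structures.
From mathcomp Require Import all_boot all_order all_algebra.
From mathcomp Require Import generic_quotient ring_quotient.
From mathcomp Require Import all_classical all_reals all_analysis.
From mathcomp Require Import measurable_realfun.
From mathcomp Require Import ring lra.

Set Implicit Arguments.
Unset Strict Implicit.
Unset Printing Implicit Defensive.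
Import Order.TTheory GRing.Theory Num.Theory.
Import numFieldNormedType.Exports.
Local Open Scope classical_set_scope.
Local Open Scope ring_scope.

Record dual_space (R : realType) (X : normedModType R) := Dual {
  dual_fun :> {linear X -> R^o};
  dual_continuous : continuous dual_fun
}.

Definition dual_norm (R : realType) (X : normedModType R) (phi : dual_space X) : R :=
  sup [set `|phi x| | x in [set x | `|x| <= 1]].

Definition dual_unit_ball (R : realType) (X : normedModType R) : set (dual_space X) :=
  [set phi | dual_norm phi <= 1].

(* The order is a Prop-valued relation rather than a MathComp porderType:
   Hierarchy-Builder rejects the join of CompleteNormedModule and Order.POrder.
   The last field is the lattice-norm axiom for the modulus |x| = x \/ (- x). *)
HB.mixin Record isBanachLattice (R : realType) E & CompleteNormedModule R E := {
  ble : E -> E -> Prop;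
  bljoin : E -> E -> E;
  blmeet : E -> E -> E;
  ble_refl : forall x, ble x x;
  ble_anti : forall x y, ble x y -> ble y x -> x = y;
  ble_trans : forall y x z, ble x y -> ble y z -> ble x z;
  bljoinP : forall x y z, ble (bljoin x y) z <-> ble x z /\ ble y z;
  blmeetP : forall x y z, ble z (blmeet x y) <-> ble z x /\ ble z y;
  ble_add2r : forall z x y : E, ble x y -> ble (x + z) (y + z);
  ble_scale : forall (a : R) (x y : E), 0 <= a -> ble x y -> ble (a *: x) (a *: y);
  ble_norm : forall x y : E,
    ble (bljoin x (- x)) (bljoin y (- y)) -> `|x| <= `|y|
}.

#[short(type="banachLatticeType")]
HB.structure Definition BanachLattice (R : realType) :=
  {E of CompleteNormedModule R E & isBanachLattice R E}.

Definition positive_cone (R : realType) (E : banachLatticeType R) : set E :=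
  [set x | ble 0 x].
Arguments positive_cone {R} E.

Section hahn_banach.
Context (R : realType) (X : normedModType R).
Implicit Types (x y : X) (r s t : R) (v : X).

Let pack_linear (f : X -> R^o) (lf : linear f) : {linear X -> R^o}
 := HB.pack f (GRing.isLinear.Build _ _ _ _ _ lf).

Let lin_dom (G : set (X * R)) :=
  (forall x y r s t, G (x, r) -> G (y, s) -> G (t *: x + y, t * r + s)) /\
  (forall x r, G (x, r) -> r <= `|x|).

Let good v (G : set (X * R)) := lin_dom G /\ (G !=set0 -> G (v, `|v|)).

Lemma lin_dom_uniq (G : set (X * R)) : lin_dom G ->
  forall x r s, G (x, r) -> G (x, s) -> r = s.
Proof.
move=> [Gl Gd].
suff H x r s : G (x, r) -> G (x, s) -> r <= s.
  by move=> x r s Gr Gs; apply/le_anti/andP; split; exact: (H x).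
move=> Gr Gs; have G0 : G (0, 0).
  have := Gl _ _ _ _ (-1) Gr Gr.
  by rewrite scaleN1r addNr mulN1r addNr.
have /Gd : G (0, r - s).
  have := Gl _ _ _ _ (-1) Gs Gr.
  by rewrite scaleN1r addNr mulN1r addrC.
by rewrite normr0 subr_le0.
Qed.

Lemma lin_dom_extend (A : set (X * R)) (x0 : X) : lin_dom A -> A !=set0 ->
  exists c, lin_dom [set p | exists y s t,
     A (y, s) /\ p = (y + t *: x0, s + t * c)].
Proof.
move=> [Al Ad] [[a0 r0] Aa0].
have A0 : A (0, 0).
  have := Al _ _ _ _ (-1) Aa0 Aa0.
  by rewrite scaleN1r addNr mulN1r addNr.
have Az x r t : A (x, r) -> A (t *: x, t * r).
  by move=> /(Al _ 0 _ 0 t); rewrite !addr0; apply.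
pose S := [set p.2 - `|p.1 - x0| | p in A].
have Sub y' s' : A (y', s') -> ubound S (`|y' + x0| - s').
  move=> A' _ [[y s] /= Ays <-].
  have /Ad : A (y + y', s + s').
    by have := Al _ _ _ _ 1 Ays A'; rewrite scale1r mul1r.
  have -> : y + y' = (y - x0) + (y' + x0) by rewrite addrACA addNr addr0.
  move=> /le_trans /(_ (ler_normD _ _)); lra.
have S0 : S !=set0 by exists (0 - `|0 - x0|), (0, 0).
have hS : has_ubound S by exists (`|0 + x0| - 0); exact: Sub.
exists (sup S); set c := sup S.
have c1 y s : A (y, s) -> s - c <= `|y - x0|.
  move=> Ays; have : s - `|y - x0| <= c.
    by apply: ub_le_sup => //; exists (y, s).
  lra.
have c2 y s : A (y, s) -> s + c <= `|y + x0|.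
  move=> Ays; have : c <= `|y + x0| - s by apply: ge_sup => //; exact: Sub.
  lra.
split.
  move=> x y r s t [y1 [s1 [t1 [A1 [-> ->]]]]] [y2 [s2 [t2 [A2 [-> ->]]]]].
  exists (t *: y1 + y2), (t * s1 + s2), (t * t1 + t2); split; first exact: Al.
  congr pair; last by ring.
  by rewrite scalerDr scalerA scalerDl addrACA.
move=> x r [y [s [t [Ays [-> ->]]]]].
have [t0|t0|->] := ltgtP t 0.
- have := c1 _ _ (Az _ _ (- t)^-1 Ays).
  have nt0 : 0 < - t by rewrite oppr_gt0.
  have -> : `|y + t *: x0| = - t * `|(- t)^-1 *: y - x0|.
    rewrite -[X in X * _]gtr0_norm// -normrZ; congr `|_|.
    rewrite scalerBr scalerA divff ?gt_eqF// scale1r scaleNr opprK//.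
  move=> h; have := ler_wpM2l (ltW nt0) h.
  rewrite mulrBr mulrA divff ?gt_eqF// mul1r; lra.
- have := c2 _ _ (Az _ _ t^-1 Ays).
  have -> : `|y + t *: x0| = t * `|t^-1 *: y + x0|.
    rewrite -[X in X * _]gtr0_norm// -normrZ; congr `|_|.
    by rewrite scalerDr scalerA divff ?gt_eqF// scale1r.
  move=> h; have := ler_wpM2l (ltW t0) h.
  by rewrite mulrDr mulrA divff ?gt_eqF// mul1r.
- by rewrite scale0r mul0r !addr0; exact: Ad.
Qed.

Lemma hahn_banach (v : X) : exists phi : dual_space X,
  phi v = `|v| /\ forall x, `|phi x| <= `|x|.
Proof.
have [|A [[[Al Ad] Av] Amax]] := @Zorn_bigcup _ (good v).
  move=> F FP Ftot; split; [split|].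
  - move=> x y r s t [G FG Gx] [H FH Hy].
    have [GH|HG] := Ftot _ _ FG FH.
    + exists H => //; have [[Hl _] _] := FP _ FH; apply: Hl => //.
      exact: GH.
    + exists G => //; have [[Gl _] _] := FP _ FG; apply: Gl => //.
      exact: HG.
  - by move=> x r [G FG Gx]; have [[_ Gd] _] := FP _ FG; exact: Gd.
  - move=> [p [G FG Gp]]; exists G => //; have [_] := FP _ FG; apply.
    by exists p.
have A0 : A !=set0.
  apply/set0P/eqP => A0.
  pose G := [set (t *: v, t * `|v|) | t in [set: R]].
  apply: (Amax G).
    rewrite A0; split; first exact: sub0set.
    by move=> /(_ (v, `|v|)); apply; exists 1; rewrite ?scale1r ?mul1r.
  split; [split|].
  - move=> x y r s t [a _ [<- <-]] [b _ [<- <-]].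
    by exists (t * a + b) => //; rewrite scalerDl scalerA mulrDl mulrA.
  - move=> x r [a _ [<- <-]]; rewrite normrZ ler_wpM2r//.
    exact: ler_norm.
  - by move=> _; exists 1; rewrite ?scale1r ?mul1r.
have {Av} := Av A0; move=> Av.
have Atot x : exists r, A (x, r).
  apply: contrapT => nAx.
  have [c Bc] := lin_dom_extend x (conj Al Ad) A0.
  set B := (X in lin_dom X) in Bc.
  have AB : A `<=` B.
    move=> [y s] Ays; exists y, s, 0; split => //.
    by rewrite scale0r mul0r !addr0.
  apply: (Amax B).
    split; first exact: AB.
    move=> BA; apply: nAx; exists c; apply: BA.
    have A00 : A (0, 0).
      have := Al _ _ _ _ (-1) Av Av.
      by rewrite scaleN1r addNr mulN1r addNr.
    exists 0, 0, 1; split => //.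
    by rewrite !add0r scale1r mul1r.
  by split => // _; exact: AB.
have [g gP] := choice Atot.
have Au := lin_dom_uniq (conj Al Ad).
have gl : linear (g : X -> R^o).
  by move=> t x y; apply: Au (gP _) _; exact: Al.
pose G : {linear X -> R^o} := pack_linear gl.
have gle x : `|g x| <= `|x|.
  rewrite ler_norml; apply/andP; split; last by have /Ad := gP x.
  have := Ad _ _ (gP (- x)); rewrite normrN.
  have -> : g (- x) = - g x by exact: (linearN G).
  by rewrite lerNl.
have Gc : continuous G.
  apply: bounded_linear_continuous; apply/bounded_funP => r; exists r => x xr.
  exact: le_trans (gle x) xr.
exists (Dual Gc); split => //.
exact: Au (gP _) Av.
Qed.

Lemma dual_sep (x : X) : (forall phi : dual_space X, phi x = 0) -> x = 0.
Proof.
have [phi [phix _]] := hahn_banach x.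
by move=> /(_ phi); rewrite phix => /normr0_eq0.
Qed.

Lemma dual_bounded (phi : dual_space X) :
  exists2 M : R, 0 < M & forall x, `|phi x| <= M * `|x|.
Proof.
have := @continuous_linear_bounded R X R^o 0 phi (dual_continuous (d:=phi) (x:=0)).
move=> /linear_boundedP [M [Mr HM]].
exists (`|M| + 1); first by rewrite ltr_pwDr.
apply: HM.
by rewrite (le_lt_trans (ler_norm M))// ltrDl.
Qed.

Lemma dual_unit_ballP (phi : dual_space X) :
  dual_unit_ball phi <-> forall x, `|phi x| <= `|x|.
Proof.
rewrite /dual_unit_ball /dual_norm /=; set S := (X in sup X); split=> [S1 x|h].
  have [->|x0] := eqVneq x 0; first by rewrite linear0 !normr0.
  have nx0 : 0 < `|x| by rewrite normr_gt0.
  have : `|phi (`|x|^-1 *: x)| <= 1.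
    apply: le_trans S1; apply: ub_le_sup.
      have [M M0 phiM] := dual_bounded phi.
      exists M => _ [y /= y1 <-]; apply: (le_trans (phiM _)).
      by rewrite ler_piMr// ltW.
    by exists (`|x|^-1 *: x) => //=; rewrite normfZV.
  rewrite linearZ normrZ normfV normr_id -ler_pdivlMl ?invr_gt0// invrK mulr1.
  exact.
apply: ge_sup; first by exists `|phi 0|, 0 => //=; rewrite normr0.
by move=> _ [y /= y1 <-]; exact: le_trans (h y) y1.
Qed.

End hahn_banach.

Section dual_uniform_boundedness.
Context (R : realType) (X : normedModType R).

Let pack_linear (f : X -> R^o) (lf : linear f) : {linear X -> R^o}
 := HB.pack f (GRing.isLinear.Build _ _ _ _ _ lf).

Let geom_eq0 (C z : R) : (forall n, `|z| <= C / 3 ^+ n) -> z = 0.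
Proof.
move=> h; apply/eqP; rewrite -normr_eq0; apply/negPn/negP => z0.
have nz : 0 < `|z| by rewrite lt_def z0 /=.
have := truncnS_gt (C / `|z|); set n := (Num.truncn _).+1 => Cn.
have := h n; rewrite ler_pdivlMr ?exprn_gt0//.
suff : C < `|z| * 3 ^+ n by rewrite ltNge => /negP.
rewrite -ltr_pdivrMl// mulrC (lt_le_trans Cn)//.
by rewrite -natrX ler_nat ltnW// ltn_expl.
Qed.

Lemma dual_uniform_bounded (K : set X) :
  (forall phi : dual_space X, exists M, forall v, K v -> `|phi v| <= M) ->
  exists M, forall v, K v -> `|v| <= M.
Proof.
move=> Kb; apply: contrapT => nK.
have /choice[v vP] : forall n : nat, exists v, K v /\ 4 ^+ n <= `|v|.
  move=> n; apply: contrapT => h; apply: nK; exists (4 ^+ n) => v Kv.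
  by rewrite leNgt; apply/negP => /ltW vn; apply: h; exists v.
have /choice[xi xiP] := fun n => hahn_banach (v n).
pose F := fix F n : X -> R := if n is m.+1 then
  fun x => F m x + (if 0 <= F m (v m) then 1 else -1) / 3 ^+ m * xi m x
  else fun=> 0.
have Fl n : linear (F n : X -> R^o).
  elim: n => [|n IH] a x y /=; first by rewrite scaler0 addr0.
  rewrite IH linearP /GRing.scale/=; ring.
have p3 n : 0 < 3 ^+ n :> R by rewrite exprn_gt0.
have sgn1 n : `|if 0 <= F n (v n) then 1 else -1| = 1 :> R.
  by case: ifP; rewrite ?normrN normr1.
have Fd n x : `|F n.+1 x - F n x| <= `|x| / 3 ^+ n.
  rewrite /= addrC addKr !normrM sgn1 mul1r normfV (gtr0_norm (p3 n)) mulrC.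
  by rewrite ler_wpM2r ?invr_ge0 ?(ltW (p3 n))//; have [_] := xiP n.
pose w n (x : X) : R := 3 / 2 * (`|x| / 3 ^+ n).
have wS n x : w n x - w n.+1 x = `|x| / 3 ^+ n.
  rewrite /w exprS invfM; field; exact: lt0r_neq0.
have w0 n x : 0 <= w n x.
  by rewrite /w !mulr_ge0// invr_ge0 ltW.
have up m n x : F n x - w n x <= F (n + m)%N x - w (n + m)%N x.
  elim: m => [|m IH]; first by rewrite addn0.
  apply: (le_trans IH); rewrite addnS.
  have := Fd (n + m)%N x; rewrite ler_norml => /andP[h _].
  have := wS (n + m)%N x; lra.
have dn m n x : F (n + m)%N x + w (n + m)%N x <= F n x + w n x.
  elim: m => [|m IH]; first by rewrite addn0.
  apply: le_trans IH; rewrite addnS.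
  have := Fd (n + m)%N x; rewrite ler_norml => /andP[_ h].
  have := wS (n + m)%N x; lra.
have ud m n x : F n x - w n x <= F m x + w m x.
  have := up m n x; have := dn n m x; rewrite addnC.
  have := w0 (n + m)%N x; lra.
pose S x := range (fun n => F n x - w n x).
pose g x := sup (S x).
have gP n x : `|g x - F n x| <= w n x.
  rewrite ler_distl; apply/andP; split.
    apply: ub_le_sup; last by exists n.
    by exists (F 0%N x + w 0%N x) => _ [m _ <-].
  apply: ge_sup; first by exists (F 0%N x - w 0%N x), 0%N.
  by move=> _ [m _ <-].
have gl : linear (g : X -> R^o).
  move=> a x y; apply/eqP; rewrite -subr_eq0; apply/eqP.
  pose C := 3 / 2 * (`|a *: x + y| + `|a| * `|x| + `|y|).
  apply: (@geom_eq0 C) => n.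
  have -> : g (a *: x + y) - (a *: (g x : R^o) + g y) =
    (g (a *: x + y) - F n (a *: x + y)) - (a * (g x - F n x) + (g y - F n y)).
    by rewrite Fl /GRing.scale/=; ring.
  apply: (le_trans (ler_normB _ _)).
  have -> : C / 3 ^+ n = w n (a *: x + y) + (`|a| * w n x + w n y).
    by rewrite /C /w; ring.
  rewrite lerD ?gP// (le_trans (ler_normD _ _))// lerD ?gP// normrM.
  by rewrite ler_wpM2l ?gP.
pose G : {linear X -> R^o} := pack_linear gl.
have Gc : continuous G.
  apply: bounded_linear_continuous; apply/bounded_funP => r; exists (3 / 2 * r).
  move=> x xr /=; have := gP 0%N x; rewrite /= subr0 /w expr0 divr1.
  by move=> /le_trans; apply; rewrite ler_wpM2l.
have [M MP] := Kb (Dual Gc).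
have lb n : 2^-1 * (`|v n| / 3 ^+ n) <= M.
  have [Kv _] := vP n; apply: le_trans (MP _ Kv); rewrite /=.
  have := gP n.+1 (v n).
  have -> : w n.+1 (v n) = 2^-1 * (`|v n| / 3 ^+ n).
    rewrite /w exprS invfM; field; exact: lt0r_neq0.
  have : `|v n| / 3 ^+ n <= `|F n.+1 (v n)|.
    have [xv _] := xiP n.
    have q0 : 0 <= `|v n| / 3 ^+ n by rewrite divr_ge0// ltW.
    rewrite /= xv; case: ifPn => [Fge|].
      by rewrite mul1r mulrC (le_trans _ (ler_norm _))// lerDr.
    rewrite -ltNge => Flt; rewrite mulN1r mulNr mulrC -[leRHS]normrN opprB.
    by rewrite (le_trans _ (ler_norm _))// lerDl oppr_ge0 ltW.
  move=> h1 h2.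
  have := ler_normB (g (v n)) (g (v n) - F n.+1 (v n)).
  rewrite opprB addrC subrK => h3; lra.
have {}lb n : n%:R <= 6 * M.
  have := lb n; have [_] := vP n => h1 h2.
  have h3 : 1 + n%:R / 3 <= (4 / 3) ^+ n :> R.
    elim: n {h1 h2} => [|n IH]; first by rewrite expr0 mul0r addr0.
    rewrite exprS; have : 0 <= n%:R :> R by [].
    rewrite -natr1; nra.
  have h4 : (4 / 3) ^+ n <= `|v n| / 3 ^+ n.
    by rewrite expr_div_n ler_wpM2r// invr_ge0 ltW.
  lra.
by have := truncnS_gt (6 * M); rewrite ltNge lb.
Qed.

End dual_uniform_boundedness.

Section charge_integral.
Context d (T : measurableType d) (R : realType).
Implicit Types (mu : {charge set T -> \bar R}) (f g : T -> R) (A : set T).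

(* jordan_pos, jordan_neg and charge_variation take a Hahn decomposition as an
   argument; by Hahn_decomposition_uniq their values on measurable sets do not
   depend on which one is chosen. *)
Definition hahn_pos mu : set T := sval (cid (Hahn_decomposition mu)).
Definition hahn_neg mu : set T := sval (cid (svalP (cid (Hahn_decomposition mu)))).

Lemma hahnP mu : hahn_decomposition mu (hahn_pos mu) (hahn_neg mu).
Proof. exact: (svalP (cid (svalP (cid (Hahn_decomposition mu))))). Qed.

Definition pos_part mu := jordan_pos (hahnP mu).
Definition neg_part mu := jordan_neg (hahnP mu).
Definition variation mu := charge_variation (hahnP mu).

HB.instance Definition _ mu := Measure.on (pos_part mu).
HB.instance Definition _ mu := Measure.on (neg_part mu).
HB.instance Definition _ mu := Measure.on (variation mu).

Definition charge_integral mu A f : R :=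
  \int[pos_part mu]_(x in A) f x - \int[neg_part mu]_(x in A) f x.

Lemma pos_partE mu A : measurable A -> pos_part mu A = mu (A `&` hahn_pos mu).
Proof.
by move=> mA; rewrite /pos_part jordan_posE cjordan_posE /crestr0 mem_set.
Qed.

Lemma neg_partE mu A :
  measurable A -> neg_part mu A = (- mu (A `&` hahn_neg mu))%E.
Proof.
by move=> mA; rewrite /neg_part jordan_negE cjordan_negE /crestr0 mem_set.
Qed.

Lemma variation_integral mu A (f : T -> \bar R) : measurable A ->
  measurable_fun A f -> (forall x, A x -> 0 <= f x)%E ->
  (\int[variation mu]_(x in A) f x =
   \int[pos_part mu]_(x in A) f x + \int[neg_part mu]_(x in A) f x)%E.
Proof.
move=> mA mf f0; rewrite -ge0_integral_measure_add//.
by apply: eq_measure_integral => B mB _; rewrite /measure_add/= /msum !big_ord_recl big_ord0 adde0.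
Qed.

Lemma variation_integrable mu A (f : T -> \bar R) : measurable A ->
  (variation mu).-integrable A f <->
  (pos_part mu).-integrable A f /\ (neg_part mu).-integrable A f.
Proof.
move=> mA; split.
  move=> /integrableP[mf fi].
  have mf' : measurable_fun A (fun x => `|f x|%E) by exact: measurableT_comp.
  rewrite variation_integral// in fi.
  have p0 : (0 <= \int[pos_part mu]_(x in A) `|f x|)%E by exact: integral_ge0.
  have n0 : (0 <= \int[neg_part mu]_(x in A) `|f x|)%E by exact: integral_ge0.
  split; apply/integrableP; split => //.
    by apply: le_lt_trans fi; rewrite leeDl.
  by apply: le_lt_trans fi; rewrite leeDr.
move=> [/integrableP[mf pi] /integrableP[_ ni]].
apply/integrableP; split => //.
rewrite variation_integral//; first by rewrite lte_add_pinfty.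
exact: measurableT_comp.
Qed.

Definition charge_integrable mu f := (variation mu).-integrable setT (EFin \o f).

Lemma charge_integrableS mu f A : measurable A -> charge_integrable mu f ->
  (pos_part mu).-integrable A (EFin \o f) /\
  (neg_part mu).-integrable A (EFin \o f).
Proof.
move=> mA /(variation_integrable _ _ measurableT)[pf nf].
by split; [move: pf|move: nf]; exact: integrableS.
Qed.

Lemma charge_integralD mu f g A : measurable A ->
  charge_integrable mu f -> charge_integrable mu g ->
  charge_integral mu A (f \+ g)%R = charge_integral mu A f + charge_integral mu A g.
Proof.
move=> mA /(charge_integrableS mA)[fp fn] /(charge_integrableS mA)[gp gn].
rewrite /charge_integral RintegralD// RintegralD//; ring.
Qed.

Lemma charge_integralZ mu f (r : R) A : measurable A ->
  charge_integrable mu f ->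
  charge_integral mu A (r \*o f)%R = r * charge_integral mu A f.
Proof.
move=> mA /(charge_integrableS mA)[fp fn].
rewrite /charge_integral RintegralZl// RintegralZl//; ring.
Qed.

Definition charge_norm mu f : \bar R := (\int[variation mu]_x `|f x|%:E)%E.

Lemma charge_norm_fin mu f : charge_integrable mu f -> charge_norm mu f \is a fin_num.
Proof.
move=> /integrableP[mf fi]; rewrite ge0_fin_numE//; last exact: integral_ge0.
Qed.

Lemma charge_norm_ge0 mu f : (0 <= charge_norm mu f)%E.
Proof. by apply: integral_ge0 => x _; rewrite lee_fin. Qed.

Lemma mfabs f : measurable_fun setT f ->
  measurable_fun setT (fun x => `|f x|%:E).
Proof. by move=> mf; apply/measurable_EFinP; exact: measurableT_comp. Qed.

Lemma charge_normD mu f g : measurable_fun setT f -> measurable_fun setT g ->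
  (charge_norm mu (f \+ g)%R <= charge_norm mu f + charge_norm mu g)%E.
Proof.
move=> mf mg; rewrite /charge_norm -ge0_integralD//; [|exact: mfabs..].
apply: ge0_le_integral => //.
- exact/mfabs/measurable_funD.
- by apply: emeasurable_funD; exact: mfabs.
- by move=> x _; rewrite -EFinD lee_fin ler_normD.
Qed.

Lemma charge_normZ mu f (r : R) : measurable_fun setT f ->
  charge_norm mu (r \*o f)%R = (`|r|%:E * charge_norm mu f)%E.
Proof.
move=> mf; rewrite /charge_norm -ge0_integralZl//; last exact: mfabs.
by apply: eq_integral => x _; rewrite /= normrM EFinM.
Qed.

Lemma charge_integral_le mu f A : measurable A -> charge_integrable mu f ->
  ((`|charge_integral mu A f|)%:E <= charge_norm mu f)%E.
Proof.
move=> mA fi; have [fp fn] := charge_integrableS mA fi.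
have /integrableP[mf _] := fi.
have [ifp ifn] := charge_integrableS measurableT fi.
apply: (@le_trans _ _ (\int[variation mu]_(x in A) `|f x|%:E)%E); last first.
  apply: ge0_subset_integral => //; apply: mfabs; exact/measurable_EFinP.
rewrite variation_integral//; last first.
  by apply: measurable_funTS; apply: mfabs; exact/measurable_EFinP.
rewrite /charge_integral.
have e (m : {measure set T -> \bar R}) : m.-integrable A (EFin \o f) ->
    (\int[m]_(x in A) `|f x|%:E)%E = (\int[m]_(x in A) `|f x|)%:E.
  move=> h; rewrite /Rintegral fineK//.
  have /integrable_fin_num -> // : m.-integrable A (fun x => (`|f x|)%:E).
  exact: integrable_abse h.
rewrite !e// -EFinD lee_fin (le_trans (ler_normB _ _))// lerD//.
  exact: le_normr_Rintegral.
exact: le_normr_Rintegral.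
Qed.

Lemma variation_null mu A : measurable A ->
  (forall B, measurable B -> B `<=` A -> mu B = 0%E) -> variation mu A = 0%E.
Proof.
move=> mA h; have [[mP _] [mN _] _ _] := hahnP mu.
transitivity (pos_part mu A + neg_part mu A)%E; first by [].
rewrite pos_partE// neg_partE// !h ?oppe0 ?adde0//; exact: measurableI.
Qed.

Lemma pos_part_integral mu f A : measurable A -> charge_integrable mu f ->
  \int[pos_part mu]_(x in A) f x = charge_integral mu (A `&` hahn_pos mu) f.
Proof.
move=> mA fi; have [[mP _] [mN _] PNT PN0] := hahnP mu.
have mAP : measurable (A `&` hahn_pos mu) by exact: measurableI.
have mAN : measurable (A `&` hahn_neg mu) by exact: measurableI.
have [fp _] := charge_integrableS mAP fi.
rewrite /charge_integral.
have -> : \int[neg_part mu]_(x in A `&` hahn_pos mu) f x = 0.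
  rewrite /Rintegral null_set_integral//.
    by apply/measurable_funTS; case/integrableP: fi.
  apply: etrans (neg_partE _ _) _ => //.
  by rewrite -setIA PN0 setI0 charge0 oppe0.
rewrite subr0 -[in LHS](setIT A) -PNT setIUr /Rintegral.
have [fA _] := charge_integrableS (measurableU _ _ mAP mAN) fi.
rewrite integral_setU//=.
  rewrite [X in (_ + X)%E]null_set_integral ?adde0//.
    by apply/measurable_funTS; case/integrableP: fi.
  apply: etrans (pos_partE _ _) _ => //.
  by rewrite -setIA (setIC (hahn_neg mu)) PN0 setI0 charge0.
- by apply/measurable_funTS; case/integrableP: fi.
- by apply/disj_setPS; rewrite setIACA PN0 setI0.
Qed.

Lemma neg_part_integral mu f A : measurable A -> charge_integrable mu f ->
  \int[neg_part mu]_(x in A) f x = - charge_integral mu (A `&` hahn_neg mu) f.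
Proof.
move=> mA fi; have [[mP _] [mN _] PNT PN0] := hahnP mu.
have mAP : measurable (A `&` hahn_pos mu) by exact: measurableI.
have mAN : measurable (A `&` hahn_neg mu) by exact: measurableI.
rewrite /charge_integral.
have -> : \int[pos_part mu]_(x in A `&` hahn_neg mu) f x = 0.
  rewrite /Rintegral null_set_integral//.
    by apply/measurable_funTS; case/integrableP: fi.
  apply: etrans (pos_partE _ _) _ => //.
  by rewrite -setIA (setIC (hahn_neg mu)) PN0 setI0 charge0.
rewrite sub0r opprK -[in LHS](setIT A) -PNT setIUr /Rintegral.
have [_ fA] := charge_integrableS (measurableU _ _ mAP mAN) fi.
rewrite integral_setU//=.
  rewrite [X in (X + _)%E]null_set_integral ?add0e//.
    by apply/measurable_funTS; case/integrableP: fi.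
  apply: etrans (neg_partE _ _) _ => //.
  by rewrite -setIA PN0 setI0 charge0 oppe0.
- by apply/measurable_funTS; case/integrableP: fi.
- by apply/disj_setPS; rewrite setIACA PN0 setI0.
Qed.

Lemma charge_norm_bound mu f (M : R) : charge_integrable mu f ->
  (forall A, measurable A -> `|charge_integral mu A f| <= M) ->
  (charge_norm mu f <= (4 * M)%:E)%E.
Proof.
move=> fi fM; have [[mP _] [mN _] _ _] := hahnP mu.
have /integrableP[/measurable_EFinP mf _] := fi.
have [fp fn] := charge_integrableS measurableT fi.
pose D : set T := [set x | 0 <= f x].
have mD : measurable D.
  rewrite (_ : D = f @^-1` `[0, +oo[).
    by rewrite -[X in measurable X]setTI; exact: mf.
  by apply/seteqP; split => x; rewrite /D/= in_itv/= andbT.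
have mDc : measurable (~` D) by exact: measurableC.
rewrite /charge_norm variation_integral//; last exact: mfabs.
have key (m : {measure set T -> \bar R}) : m.-integrable setT (EFin \o f) ->
  (forall A, measurable A -> `|\int[m]_(x in A) f x| <= M) ->
  (\int[m]_x `|f x|%:E <= (2 * M)%:E)%E.
  move=> im h.
  have -> : (\int[m]_x `|f x|%:E = \int[m]_(x in D `|` ~` D) `|f x|%:E)%E.
    by rewrite setUv.
  rewrite ge0_integral_setU//; last 2 first.
  - by apply: measurable_funTS; exact: mfabs.
  - by apply/disj_setPS; rewrite setICr.
  have iD : m.-integrable D (EFin \o f) by move: im; exact: integrableS.
  have iDc : m.-integrable (~` D) (EFin \o f) by move: im; exact: integrableS.
  have -> : (\int[m]_(x in D) `|f x|%:E = (\int[m]_(x in D) f x)%:E)%E.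
    rewrite /Rintegral fineK ?integrable_fin_num//.
    by apply: eq_integral => x; rewrite inE => Dx; rewrite ger0_norm.
  have -> : (\int[m]_(x in ~` D) `|f x|%:E = (- \int[m]_(x in ~` D) f x)%:E)%E.
    rewrite EFinN /Rintegral fineK ?integrable_fin_num// -integralN//.
      apply: eq_integral => x; rewrite inE /D/= => /negP.
      by rewrite -ltNge => /ltr0_norm ->.
    exact: integrable_add_def.
  rewrite -EFinD lee_fin.
  have := h D mD; have := h _ mDc; rewrite !ler_norml.
  move=> /andP[? _] /andP[_ ?]; lra.
have -> : 4 * M = 2 * M + 2 * M by ring.
rewrite EFinD leeD// key// => A mA.
  by rewrite pos_part_integral// fM//; exact: measurableI.
by rewrite neg_part_integral// normrN fM//; exact: measurableI.
Qed.

End charge_integral.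

(* Values outside the sigma-algebra are junk, as for the measures of the
   library; everything below only looks at measurable sets. *)
Record vector_measure d (T : measurableType d) (R : realType)
    (E : normedModType R) := VectorMeasure {
  vm_fun :> set T -> E;
  vm_sigma_additive : forall F : (set T)^nat,
    (forall i, measurable (F i)) -> trivIset setT F ->
    series (fun i => vm_fun (F i)) @ \oo --> vm_fun (\bigcup_i F i)
}.
Arguments vm_sigma_additive {d T R E} _ {F}.

Section vector_measure.
Context d (T : measurableType d) (R : realType) (E : normedModType R).
Implicit Types (nu : vector_measure T E) (A B Z : set T) (phi : dual_space E).
Implicit Types (f g : T -> R) (r : R).

Lemma vm0 nu : nu set0 = 0.
Proof.
have h := vm_sigma_additive nu (fun=> measurable0)
  (@trivIset_set0 _ _ _).
have /cvg_series_cvg_0 : cvgn (series (fun=> nu set0)) by apply: cvgP h.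
move=> /cvg_lim <-//; apply/esym/cvg_lim => //; exact: cvg_cst.
Qed.

Definition scalar_measure nu phi : set T -> \bar R := fun A => (phi (nu A))%:E.

Section scalar_measure.
Variables (nu : vector_measure T E) (phi : dual_space E).
Let mu := scalar_measure nu phi.

Let mu0 : mu set0 = 0%E.
Proof. by rewrite /mu /scalar_measure vm0 linear0. Qed.

Let mu_fin A : measurable A -> mu A \is a fin_num.
Proof. by []. Qed.

Let mu_sigma_additive : semi_sigma_additive mu.
Proof.
move=> F mF tF _; rewrite /mu /scalar_measure.
have h := vm_sigma_additive nu mF tF.
have h2 : (phi \o series (fun i => nu (F i))) n @[n --> \oo] -->
    phi (nu (\bigcup_i F i)).
  by apply: (cvg_comp _ _ h); exact: dual_continuous.
rewrite (_ : (fun n => _) =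
    EFin \o (phi \o series (fun i => nu (F i)) : nat -> R)).
  by apply: cvg_EFin; [exact: nearW|exact: h2].
by apply/funext => n /=; rewrite /series/= linear_sum sumEFin.
Qed.

HB.instance Definition _ :=
  isCharge.Build d T R (scalar_measure nu phi) mu0 mu_fin mu_sigma_additive.

End scalar_measure.

Definition vm_null nu A :=
  measurable A /\ forall B, measurable B -> B `<=` A -> nu B = 0.

Definition vm_atom nu A :=
  [/\ measurable A, ~ vm_null nu A &
     forall B, measurable B -> B `<=` A -> vm_null nu B \/ vm_null nu (A `\` B)].

Definition non_atomic nu := forall A, ~ vm_atom nu A.

Definition vm_range nu : set E := [set nu A | A in measurable].

Definition vm_integrable nu (f : T -> R) :=
  [/\ measurable_fun setT f,
      forall phi, (variation (scalar_measure nu phi)).-integrable setT (EFin \o f) &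
      forall A, measurable A -> exists v : E, forall phi,
        phi v = charge_integral (scalar_measure nu phi) A f].

(* Lemma vm_norm_fin shows that this is finite for nu-integrable functions. *)
Definition vm_norm nu (f : T -> R) : \bar R :=
  ereal_sup [set (\int[variation (scalar_measure nu phi)]_x `|f x|%:E)%E
            | phi in @dual_unit_ball R E].

Definition vm_ae_eq nu (f g : T -> R) :=
  exists2 Z, vm_null nu Z & forall x, ~ Z x -> f x = g x.

Lemma vm_nullU nu A B : vm_null nu A -> vm_null nu B -> vm_null nu (A `|` B).
Proof.
move=> [mA A0] [mB B0]; split; first exact: measurableU.
move=> C mC CAB.
have mCA : measurable (C `&` A) by exact: measurableI.
have mCB : measurable (C `\` A) by exact: measurableD.
apply: dual_sep => phi.
have CBB : C `\` A `<=` B by move=> x [/CAB[]//].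
suff : scalar_measure nu phi C = 0%E by move=> [].
rewrite (chargeDI (scalar_measure nu phi) mC mA) /= /scalar_measure.
by rewrite (A0 _ mCA (@subIsetr _ _ _)) (B0 _ mCB CBB) linear0 adde0.
Qed.

Lemma vm_null_variation nu Z phi :
  vm_null nu Z -> variation (scalar_measure nu phi) Z = 0%E.
Proof.
move=> [mZ Z0]; apply: variation_null => // B mB BZ.
by transitivity (phi (nu B))%:E => //; rewrite Z0// linear0.
Qed.

Lemma dual_unit_ball_neq0 : exists phi : dual_space E, dual_unit_ball phi.
Proof.
have [phi [_ h]] := hahn_banach (0 : E).
by exists phi; apply/dual_unit_ballP.
Qed.

Lemma vm_norm_ge0 nu f : (0 <= vm_norm nu f)%E.
Proof.
have [phi bphi] := dual_unit_ball_neq0.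
apply: ereal_sup_ge; exists (charge_norm (scalar_measure nu phi) f).
  by exists phi.
exact: charge_norm_ge0.
Qed.

Lemma vm_norm_fin nu f : vm_integrable nu f -> vm_norm nu f \is a fin_num.
Proof.
move=> [mf fi fv]; rewrite ge0_fin_numE; last exact: vm_norm_ge0.
pose K := [set v : E | exists2 A, measurable A &
  forall phi, phi v = charge_integral (scalar_measure nu phi) A f].
have [|M KM] := @dual_uniform_bounded R E K.
  move=> phi; exists (fine (charge_norm (scalar_measure nu phi) f)).
  move=> v [A mA ->]; rewrite -lee_fin fineK.
    exact: charge_integral_le mA (fi phi).
  exact: charge_norm_fin (fi phi).
apply: (@le_lt_trans _ _ (4 * M)%:E); last exact: ltry.
apply: ge_ereal_sup => _ [phi bphi <-].
apply: (charge_norm_bound (fi phi)) => A mA.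
have [v vP] := fv A mA; rewrite -vP.
have /dual_unit_ballP h := bphi; apply: (le_trans (h v)).
by apply: KM; exists A.
Qed.

Lemma vm_normD nu f g : measurable_fun setT f -> measurable_fun setT g ->
  (vm_norm nu (f \+ g)%R <= vm_norm nu f + vm_norm nu g)%E.
Proof.
move=> mf mg; apply: ge_ereal_sup => _ [phi bphi <-].
apply: (le_trans (charge_normD _ mf mg)).
by apply: leeD; apply: ereal_sup_ubound; exists phi.
Qed.

Lemma vm_normZ nu f r : vm_integrable nu f ->
  vm_norm nu (r \*o f)%R = (`|r|%:E * vm_norm nu f)%E.
Proof.
move=> fi; have [mf _ _] := fi.
have le s g : measurable_fun setT g ->
  (vm_norm nu (s \*o g)%R <= `|s|%:E * vm_norm nu g)%E.
  move=> mg; apply: ge_ereal_sup => _ [phi bphi <-].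
  rewrite [leLHS](charge_normZ _ _ mg); apply: lee_wpmul2l => //.
  by apply: ereal_sup_ubound; exists phi.
apply/eqP; rewrite eq_le le//=.
have [->|r0] := eqVneq r 0.
  by rewrite normr0 mul0e vm_norm_ge0.
have := le r^-1 (r \*o f)%R (measurable_funM (measurable_cst _) mf).
rewrite (_ : r^-1 \*o (r \*o f) = f)%R; last first.
  by apply/funext => x /=; rewrite mulrA mulVf// mul1r.
move=> h; rewrite -lee_pdivlMl ?normr_gt0//.
by move: h; rewrite normfV.
Qed.

Lemma vm_norm_null nu f : vm_ae_eq nu f (fun=> 0) -> measurable_fun setT f ->
  vm_norm nu f = 0%E.
Proof.
move=> [Z nZ fZ] mf; apply/eqP; rewrite eq_le vm_norm_ge0 andbT.
apply: ge_ereal_sup => _ [phi bphi <-].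
have Z0 := vm_null_variation phi nZ.
have [mZ _] := nZ.
rewrite le_eqVlt; apply/orP; left; apply/eqP.
rewrite (_ : (\int[_]_x _)%E = (\int[variation (scalar_measure nu phi)]_x (`|(f x)%:E|)))%E; last by [].
apply/ae_eq_integral_abs => //; first exact/measurable_EFinP.
exists Z; split => // x /= h; apply: contrapT => nZx; apply: h => _.
by rewrite fZ.
Qed.

Lemma vm_norm_eq0 nu f : measurable_fun setT f -> vm_norm nu f = 0%E ->
  vm_ae_eq nu f (fun=> 0).
Proof.
move=> mf f0; pose Z := [set x | f x != 0].
have mZ : measurable Z.
  rewrite (_ : Z = f @^-1` [set~ 0]).
    by rewrite -[X in measurable X]setTI; apply: mf => //; exact: measurableC.
  by apply/seteqP; split => x /=; [move/eqP|move/eqP].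
exists Z; last by move=> x /negP/negPn/eqP.
split=> // B mB BZ.
have key phi : dual_unit_ball phi -> phi (nu B) = 0.
  move=> bphi; set mu := scalar_measure nu phi.
  have : (\int[variation mu]_x (`|(f x)%:E|) = 0)%E.
    apply/eqP; rewrite eq_le integral_ge0// andbT -f0.
    by apply: ereal_sup_ubound; exists phi.
  move/ae_eq_integral_abs => /(_ measurableT).
  case; first exact/measurable_EFinP.
  move=> N [mN N0 NZ].
  have : (`|mu B| <= 0)%E.
    apply: (le_trans (abse_charge_variation (hahnP _) mB)).
    rewrite -N0; apply: le_measure; rewrite ?inE//.
    move=> x Bx; apply: NZ => /= /(_ I)[fx]; move/BZ : Bx.
    by rewrite /Z/= fx eqxx.
  by rewrite lee_fin normr_le0 => /eqP.
have [phi [phiv phile]] := hahn_banach (nu B).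
apply/normr0_eq0; rewrite -phiv; apply: key; exact/dual_unit_ballP.
Qed.

End vector_measure.

Section L1.
Context d (T : measurableType d) (R : realType) (E : normedModType R).
Variable nu : vector_measure T E.

Definition vm_integrable_pred : {pred {mfun T >-> R}} :=
  fun f => `[< vm_integrable nu f >].

Lemma vm_integrable_submod_closed : submod_closed vm_integrable_pred.
Proof.
split.
  apply/asboolP; split => //.
    move=> phi; rewrite (_ : _ \o _ = cst 0%E)//; exact: integrable0.
  move=> A mA; exists 0 => phi; rewrite linear0 /charge_integral.
  by rewrite !Rintegral_cst// !mul0r subr0.
move=> r f g /asboolP[mf fi fv] /asboolP[mg gi gv]; apply/asboolP; split => //.
  move=> phi; rewrite (_ : _ \o _ =
      ((fun x => r%:E * (f x)%:E) \+ (fun x => (g x)%:E))%E)//.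
  apply: integrableD => //; first by apply: integrableZl => //; exact: fi.
  exact: gi.
move=> A mA; have [v vP] := fv A mA; have [w wP] := gv A mA.
exists (r *: v + w) => phi; rewrite linearP vP wP.
have fi' : charge_integrable (scalar_measure nu phi) (r \*o f)%R.
  rewrite /charge_integrable (_ : _ \o _ = (fun x => r%:E * (f x)%:E)%E)//.
  by apply: integrableZl => //; exact: fi.
rewrite [RHS](charge_integralD mA fi' (gi phi)).
by rewrite (charge_integralZ _ mA (fi phi)).
Qed.

HB.instance Definition _ := GRing.isSubmodClosed.Build _ _ vm_integrable_pred
  vm_integrable_submod_closed.

Record L1fun := MkL1fun {
  L1fun_mfun :> {mfun T >-> R};
  L1fun_integrable : L1fun_mfun \in vm_integrable_pred
}.

HB.instance Definition _ := [isSub for L1fun_mfun].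
HB.instance Definition _ := [Choice of L1fun by <:].
HB.instance Definition _ := [SubChoice_isSubLmodule of L1fun by <:].

Definition L1null : {pred L1fun} := fun f => `[< vm_ae_eq nu f (fun=> 0) >].

Lemma L1null_submod_closed : submod_closed L1null.
Proof.
split.
  apply/asboolP; exists set0 => //; split => // B mB; rewrite subset0 => ->.
  exact: vm0.
move=> r f g /asboolP[Z nZ fZ] /asboolP[Y nY gY]; apply/asboolP.
exists (Z `|` Y); first exact: vm_nullU.
move=> x /not_orP[nZx nYx].
by rewrite -[LHS]/(r * f x + g x) fZ// gY// mulr0 addr0.
Qed.

HB.instance Definition _ := GRing.isSubmodClosed.Build _ _ L1null
  L1null_submod_closed.

(* Two integrable functions are identified when their difference is null; by
   lemma L1eqP this is equality outside a nu-null set. *)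
Definition L1 := Quotient.quot (L1null : zmodClosed L1fun).
HB.instance Definition _ := GRing.Zmodule.on L1.

Definition L1class (f : L1fun) : L1 := \pi_(L1)%qT f.
Definition L1repr (f : L1) : L1fun := repr f.

Lemma L1reprK : cancel L1repr L1class.
Proof. exact: reprK. Qed.

Lemma L1classD (f g : L1fun) : L1class (f + g) = L1class f + L1class g.
Proof. exact: (raddfD (\pi_(Quotient.quot (L1null : zmodClosed L1fun)))%qT). Qed.

Lemma L1class_eq (f g : L1fun) : L1class f = L1class g <-> f - g \in L1null.
Proof.
rewrite (Quotient.idealrBE (L1null : zmodClosed L1fun)).
by split=> /eqP.
Qed.

Lemma L1eqP (f g : L1fun) : L1class f = L1class g <-> vm_ae_eq nu f g.
Proof.
rewrite L1class_eq; split.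
  move=> /asboolP[Z nZ fgZ]; exists Z => // x /fgZ; rewrite -[LHS]/(f x - g x).
  by move/eqP; rewrite subr_eq0 => /eqP.
move=> [Z nZ fgZ]; apply/asboolP; exists Z => // x /fgZ fgx.
by rewrite -[LHS]/(f x - g x) fgx subrr.
Qed.

Definition L1scale (r : R) (f : L1) : L1 := L1class (r *: L1repr f).

Lemma L1scaleE (r : R) (f : L1fun) : L1scale r (L1class f) = L1class (r *: f).
Proof.
apply/L1class_eq; rewrite -scalerBr rpredZ//.
by apply/L1class_eq; rewrite L1reprK.
Qed.

Let L1scaleA (a b : R) (f : L1) : L1scale a (L1scale b f) = L1scale (a * b) f.
Proof. by rewrite -(L1reprK f) !L1scaleE scalerA. Qed.

Let L1scale1 : left_id 1 L1scale.
Proof. by move=> f; rewrite -(L1reprK f) L1scaleE scale1r. Qed.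

Let L1scaleDr : right_distributive L1scale +%R.
Proof.
move=> a f g; rewrite -(L1reprK f) -(L1reprK g).
by rewrite -L1classD !L1scaleE scalerDr L1classD.
Qed.

Let L1scaleDl (f : L1) : {morph L1scale^~ f : a b / a + b}.
Proof.
by move=> a b; rewrite -(L1reprK f) !L1scaleE scalerDl L1classD.
Qed.

HB.instance Definition _ := GRing.Zmodule_isLmodule.Build R L1
  L1scaleA L1scale1 L1scaleDr L1scaleDl.

(* Lemma L1normE: the norm does not depend on the representative. *)
Definition L1norm (f : L1) : R := fine (vm_norm nu (L1repr f)).

Let L1funP (f : L1fun) : vm_integrable nu f.
Proof. by have /asboolP := L1fun_integrable f. Qed.

Let vmnD (f g : L1fun) : fine (vm_norm nu (f + g)) <=
  fine (vm_norm nu f) + fine (vm_norm nu g).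
Proof.
have mf (h : L1fun) : measurable_fun setT h by have [] := L1funP h.
have fn (h : L1fun) : vm_norm nu h \is a fin_num by exact/vm_norm_fin/L1funP.
rewrite -lee_fin EFinD (fineK (fn f)) (fineK (fn g)) (fineK (fn (f + g))).
exact: (vm_normD nu (mf f) (mf g)).
Qed.

Let vmnN0 (f : L1fun) : f \in L1null -> fine (vm_norm nu f) = 0.
Proof. by move=> /asboolP fz; rewrite vm_norm_null. Qed.

Lemma L1normE (f : L1fun) : L1norm (L1class f) = fine (vm_norm nu f).
Proof.
rewrite /L1norm; set g := L1repr _.
have gf : L1class g = L1class f by rewrite L1reprK.
have gf0 := vmnN0 ((L1class_eq _ _).1 gf).
have fg0 := vmnN0 ((L1class_eq _ _).1 (esym gf)).
apply/eqP; rewrite eq_le; apply/andP; split.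
  by have := vmnD (g - f) f; rewrite subrK gf0 add0r.
by have := vmnD (f - g) g; rewrite subrK fg0 add0r.
Qed.

Let L1normD (f g : L1) : L1norm (f + g) <= L1norm f + L1norm g.
Proof. by rewrite -(L1reprK f) -(L1reprK g) -L1classD !L1normE. Qed.

Let L1normZ (r : R) (f : L1) : L1norm (r *: f) = `|r| * L1norm f.
Proof.
rewrite -(L1reprK f) [_ *: _]L1scaleE !L1normE.
rewrite (_ : L1fun_mfun _ = (r \*o L1repr f)%R :> (T -> R))//.
by rewrite vm_normZ// fineM// vm_norm_fin.
Qed.

Let L1norm_eq0 (f : L1) : L1norm f = 0 -> f = 0.
Proof.
rewrite -(L1reprK f) L1normE => f0.
rewrite (_ : 0 = L1class 0); last first.
  apply: (addIr (L1class 0)); by rewrite -L1classD addr0 add0r.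
apply/L1class_eq; rewrite subr0; apply/asboolP; apply: vm_norm_eq0 => //.
by rewrite -[LHS]fineK ?f0// vm_norm_fin.
Qed.

HB.instance Definition _ := Lmodule_isNormed.Build R L1
  L1normD L1normZ L1norm_eq0.

Lemma norm_L1class (f : L1fun) : `|L1class f| = fine (vm_norm nu f).
Proof. exact: L1normE. Qed.

Lemma scale_L1class (r : R) (f : L1fun) : r *: L1class f = L1class (r *: f).
Proof. exact: L1scaleE. Qed.

End L1.

Definition weakly_null (R : realType) (X : normedModType R) (y : X^nat) :=
  forall phi : dual_space X, phi (y n) @[n --> \oo] --> (0 : R).

Definition WASQ (R : realType) (X : normedModType R) :=
  forall x : X, `|x| = 1 -> exists y : X^nat,
    [/\ weakly_null y,
        forall n, `|y n| <= 1,
        `|x + y n| @[n --> \oo] --> (1 : R),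
        `|x - y n| @[n --> \oo] --> (1 : R) &
        `|y n| @[n --> \oo] --> (1 : R)].

(* Main.v *)
Require Import Defs.
From HB Require Import structures.
From mathcomp Require Import all_boot all_order all_algebra.
From mathcomp Require Import finmap.
From mathcomp Require Import all_classical all_reals all_analysis.
From mathcomp Require Import measurable_realfun.
From mathcomp Require Import ring lra.
Import Order.TTheory GRing.Theory Num.Theory.
Import numFieldNormedType.Exports.
Import HBSimple.
Local Open Scope classical_set_scope.
Local Open Scope ring_scope.

Set Implicit Arguments.
Unset Strict Implicit.
Unset Printing Implicit Defensive.

(** For [f] of norm one take [y_n = f r_n] where the [r_n] are [+-1]-valued and
    behave like Rademacher functions. Then [|y_n| = |f|], and since [nu >= 0] the
    norm of [g] in [L1 nu] is that of the vector [\int |g| d nu], so that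
    [|f +- y_n|] is the norm of [\int |f| d nu +- \int |f| r_n d nu]. It remains to
    see that [y_n] is weakly null and that [\int |f| r_n d nu] tends to 0 in norm.

    The compactness of the range gives countably many functionals separating it
    from 0, hence a finite measure [mu] with the same null sets as [nu]. It is
    non-atomic, so any set can be halved, simultaneously along finitely many given
    sets; this produces [A_n] such that the functions [r_n = 2 1_{A_n} - 1] are
    orthogonal in [L2 mu]. By Bessel's inequality and Radon-Nikodym
    [m (B `&` A_n)] tends to [m B / 2] for every charge [m << nu]. For [f = 1_B]
    this is the weak convergence of [y_n], and the weak convergence of
    [\int |f| r_n d nu], which is norm convergence by compactness. Finally simple
    functions are dense in [L1 nu]: a decreasing weakly null sequence of positive
    vectors tends to 0 in norm, as a functional separating the vectors from 0
    would contradict weak nullity. *)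

(** * Sublinear functionals and the Mazur-Orlicz theorem *)

Section sublinear.
Context (R : realType) (V : lmodType R).
Implicit Types (q : V -> R) (C : set (V * R)).

Definition sublinear q :=
  (forall x y, q (x + y) <= q x + q y) /\
  (forall t x, 0 <= t -> q (t *: x) = t * q x).

(** A pair [(w, s)] stands for the requirement [s <= f w] on a linear [f <= q]. The first three
    clauses close the requirements under nonnegative combinations, and the last one is the
    consistency condition forced by [f <= q]. *)
Definition cone_below q C :=
  [/\ C (0, 0),
      forall w s w' s', C (w, s) -> C (w', s') -> C (w + w', s + s'),
      forall t w s, 0 <= t -> C (w, s) -> C (t *: w, t * s) &
      forall w s, C (w, s) -> s <= q w].

Lemma sublinear0 q : sublinear q -> q 0 = 0.
Proof. by move=> [_ qZ]; rewrite -(scale0r 0) qZ// mul0r. Qed.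

Lemma sublinear_ge q x : sublinear q -> - q (- x) <= q x.
Proof.
move=> sq; rewrite lerNl -subr_ge0 opprK -(sublinear0 sq) addrC.
by have [qD _] := sq; rewrite -(subrr x).
Qed.

(** The infimum of [q (x + w) - s] over [(w, s)] in [C] is sublinear because [C] is a cone, and
    finite because [s <= q w]. Any linear [f] below it meets the requirements in [C], since
    [- f w = f (- w) <= - s]. *)
Lemma sublinear_cone q C : sublinear q -> cone_below q C ->
  exists q', [/\ sublinear q', forall x, q' x <= q x &
    forall w s, C (w, s) -> q' (- w) <= - s].
Proof.
move=> sq [C0 CD CZ Cq]; have [qD qZ] := sq.
pose S x := [set q (x + c.1) - c.2 | c in C].
have S0 x : S x !=set0 by exists (q (x + 0) - 0), (0, 0).
have lS x : lbound (S x) (- q (- x)).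
  move=> _ [[w s] /= Cws <-]; have := Cq _ _ Cws.
  have := qD (x + w) (- x); rewrite addrAC subrr add0r; lra.
have hS x : has_lbound (S x) by exists (- q (- x)); exact: lS.
pose q' x := inf (S x).
have q'le x w s : C (w, s) -> q' x <= q (x + w) - s.
  by move=> Cws; apply: ge_inf => //; exists (w, s).
have q'ge x r : (forall w s, C (w, s) -> r <= q (x + w) - s) -> r <= q' x.
  by move=> h; apply: lb_le_inf => // _ [[w s] /= Cws <-]; exact: h.
have q'Zle t x : 0 < t -> q' (t *: x) <= t * q' x.
  move=> t0; rewrite -ler_pdivrMl//; apply: (q'ge) => w s Cws.
  rewrite ler_pdivrMl//; apply: (le_trans (q'le _ _ _ (CZ _ _ _ (ltW t0) Cws))).
  by rewrite -scalerDr qZ ?(ltW t0)// mulrBr.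
exists q'; split; [split| |].
- move=> x y; rewrite -lerBlDl; apply: (q'ge) => w s Cws.
  rewrite lerBlDl -lerBlDr; apply: (q'ge) => w' s' Cws'.
  have := q'le (x + y) _ _ (CD _ _ _ _ Cws Cws').
  have := qD (y + w) (x + w'); rewrite addrACA (addrC y) (addrC w); lra.
- move=> t x; rewrite le_eqVlt => /predU1P[<-|t0].
    rewrite scale0r mul0r; apply/eqP; rewrite eq_le; apply/andP; split.
      by have := q'le 0 _ _ C0; rewrite addr0 (sublinear0 sq) subr0.
    by apply: (q'ge) => w s /Cq; rewrite add0r subr_ge0.
  apply/eqP; rewrite eq_le q'Zle//= -ler_pdivlMl//.
  have := q'Zle t^-1 (t *: x); rewrite invr_gt0 => /(_ t0).
  by rewrite scalerA mulVf ?gt_eqF// scale1r.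
- by move=> x; have := q'le x _ _ C0; rewrite addr0 subr0.
- by move=> w s Cws; have := q'le (- w) _ _ Cws; rewrite addNr (sublinear0 sq) sub0r.
Qed.

Let pack_linear (f : V -> R^o) (lf : linear f) : {linear V -> R^o}
 := HB.pack f (GRing.isLinear.Build _ _ _ _ _ lf).

(* A minimal sublinear functional q is linear: by minimality
   inf_(t >= 0) (q (x + t y) - t q y) = q x, that is q x + q y <= q (x + y). *)
Lemma linear_le_sublinear q : sublinear q ->
  exists f : {linear V -> R^o}, forall x, f x <= q x.
Proof.
move=> sq.
pose W := {g : V -> R | sublinear g /\ forall x, g x <= q x}.
(* The order is reversed, so that Zorn's lemma yields a minimal sublinear functional below [q]. *)
pose rW (g h : W) := `[< forall x, sval h x <= sval g x >].
have [||||[g [sg gq]] gmin] := @Zorn W rW.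
- by move=> g; apply/asboolP.
- move=> g h k /asboolP hg /asboolP kh; apply/asboolP => x.
  exact: le_trans (kh x) (hg x).
- move=> [g Pg] [h Ph] /asboolP hg /asboolP gh; apply: eq_exist => /=.
  by apply/funext => x; apply/eqP; rewrite eq_le (hg x) (gh x).
- move=> A Atot; have [[a Aa]|A0] := pselect (A !=set0); last first.
    exists (exist _ q (conj sq (fun=> lexx _))) => s As.
    by exfalso; apply: A0; exists s.
  (* A nonempty chain is bounded by its pointwise infimum, which is finite because
     [- q (- x) <= - g (- x) <= g x] for every [g] in the chain. *)
  pose S x := [set sval g x | g in A].
  have S0 x : S x !=set0 by exists (sval a x), a.
  have lS x : lbound (S x) (- q (- x)).
    move=> _ [[g [sg gq]] /= _ <-]; apply: le_trans (sublinear_ge x sg).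
    by rewrite lerN2.
  have hS x : has_lbound (S x) by exists (- q (- x)); exact: lS.
  pose m x := inf (S x).
  have mle x g : A g -> m x <= sval g x.
    by move=> Ag; apply: ge_inf => //; exists g.
  have mge x r : (forall g, A g -> r <= sval g x) -> r <= m x.
    by move=> h; apply: lb_le_inf => // _ [g /= Ag <-]; exact: h.
  have mZle t x : 0 < t -> m (t *: x) <= t * m x.
    move=> t0; rewrite -ler_pdivrMl//; apply: (mge) => g Ag.
    rewrite ler_pdivrMl//; apply: (le_trans (mle _ _ Ag)).
    by have [[_ gZ] _] := svalP g; rewrite gZ ?(ltW t0).
  have sm : sublinear m.
    split.
    + move=> x y; rewrite -lerBlDl; apply: (mge) => g Ag.
      rewrite lerBlDl -lerBlDr; apply: (mge) => h Ah; rewrite lerBlDr.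
      have [[gD _] _] := svalP g; have [[hD _] _] := svalP h.
      (* Two members of the chain are comparable, and subadditivity of the smaller one bounds
         [m (x + y)]. *)
      have [/asboolP gh|/asboolP gh] := Atot _ _ Ag Ah.
      * apply: (le_trans (mle _ _ Ah)); apply: (le_trans (hD _ _)).
        by rewrite lerD2l.
      * apply: (le_trans (mle _ _ Ag)); apply: (le_trans (gD _ _)).
        by rewrite lerD2r.
    + move=> t x; rewrite le_eqVlt => /predU1P[<-|t0].
        rewrite scale0r mul0r; apply/eqP; rewrite eq_le; apply/andP; split.
          apply: (le_trans (mle _ _ Aa)).
          by have [sa _] := svalP a; rewrite (sublinear0 sa).
        by apply: (mge) => g _; have [sg _] := svalP g; rewrite (sublinear0 sg).
      apply/eqP; rewrite eq_le mZle//= -ler_pdivlMl//.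
      have := mZle t^-1 (t *: x); rewrite invr_gt0 => /(_ t0).
      by rewrite scalerA mulVf ?gt_eqF// scale1r.
  have mq x : m x <= q x.
    by apply: (le_trans (mle _ _ Aa)); have [_] := svalP a; exact.
  exists (exist _ m (conj sm mq)) => g Ag; apply/asboolP => x; exact: mle.
have gsup x y : g x + g y <= g (x + y).
  pose C := [set c | exists2 t, 0 <= t & c = (t *: y, t * g y)].
  have [||g' [sg' g'g Cg']] := @sublinear_cone g C => //.
    split.
    - by exists 0; rewrite // scale0r mul0r.
    - move=> _ _ _ _ [t t0 [-> ->]] [t' t'0 [-> ->]].
      by exists (t + t'); rewrite ?addr_ge0// scalerDl mulrDl.
    - move=> r _ _ r0 [t t0 [-> ->]].
      by exists (r * t); rewrite ?mulr_ge0// scalerA mulrA.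
    - by move=> _ _ [t t0 [-> ->]]; have [_ ->] := sg.
  have g'q z : g' z <= q z := le_trans (g'g z) (gq z).
  have /(congr1 sval)/= gg' : exist _ g' (conj sg' g'q) = exist _ g (conj sg gq) :> W.
    by apply: gmin; exact/asboolP.
  rewrite gg' in Cg'; have : g (- y) <= - g y.
    by apply: Cg'; exists 1; rewrite ?scale1r ?mul1r.
  have [gD _] := sg; have := gD (x + y) (- y); rewrite addrK; lra.
have gD x y : g (x + y) = g x + g y.
  by have [gD _] := sg; apply/eqP; rewrite eq_le gD gsup.
have gN x : g (- x) = - g x.
  by have := gD x (- x); rewrite subrr (sublinear0 sg); lra.
have gl : linear (g : V -> R^o).
  move=> t x y; rewrite gD; congr (_ + _); have [_ gZ] := sg.
  have [t0|t0] := leP 0 t; first exact: gZ.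
  have := gZ (- t) x; rewrite scaleNr gN oppr_ge0 (ltW t0) => /(_ isT).
  by rewrite mulNr => /oppr_inj.
by exists (pack_linear gl).
Qed.

End sublinear.

Section mazur_orlicz.
Context (R : realType) (X : normedModType R).

(** [sublinear_cone] builds the requirements into a sublinear functional below the norm, and a
    linear functional below that one satisfies them. The bound [phi x <= |x|] at [x] and [- x] gives
    continuity. *)
Lemma mazur_orlicz (C : set (X * R)) : cone_below (fun x => `|x|) C ->
  exists phi : dual_space X, (forall x, `|phi x| <= `|x|) /\
    forall w s, C (w, s) -> s <= phi w.
Proof.
move=> Cq.
have sn : sublinear (fun x : X => `|x|).
  split => [x y|t x t0]; first exact: ler_normD.
  by rewrite normrZ ger0_norm.
have [q [sq qn Cle]] := sublinear_cone sn Cq.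
have [f fq] := linear_le_sublinear sq.
have fn x : `|f x| <= `|x|.
  rewrite ler_norml lerNl -(linearN f) -normrN.
  by rewrite (le_trans (fq _) (qn _)) normrN (le_trans (fq _) (qn _)).
have fc : continuous f.
  apply: bounded_linear_continuous; apply/bounded_funP => r; exists r => x.
  exact: le_trans (fn x).
exists (Dual fc); split => // w s Cws; rewrite -lerN2 -(linearN f).
exact: le_trans (fq _) (Cle _ _ Cws).
Qed.

End mazur_orlicz.

(** * Banach lattices *)

Section banach_lattice.
Context (R : realType) (E : banachLatticeType R).
Implicit Types (x y u v w : E).

Lemma ble_addr x y w : ble 0 w -> ble x y -> ble x (y + w).
Proof.
move=> w0 xy; apply: ble_trans xy _.
by have := ble_add2r y _ _ w0; rewrite add0r addrC.
Qed.

Lemma ble_subr_ge0 x y : ble 0 (y - x) <-> ble x y.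
Proof.
split=> h; first by have := ble_add2r x _ _ h; rewrite add0r subrK.
by have := ble_add2r (- x) _ _ h; rewrite subrr.
Qed.

Lemma ble_addr_ge0 x y : ble 0 x -> ble 0 y -> ble 0 (x + y).
Proof. by move=> x0 y0; exact: ble_addr. Qed.

Lemma ble_scale_ge0 (t : R) x : 0 <= t -> ble 0 x -> ble 0 (t *: x).
Proof. by move=> t0 /(ble_scale _ _ _ t0); rewrite scaler0. Qed.

Definition bl_abs x := bljoin x (- x).

Lemma bl_abs_ge x : ble x (bl_abs x).
Proof. by have [] := (bljoinP x (- x) (bl_abs x)).1 (ble_refl _). Qed.

Lemma bl_abs_geN x : ble (- x) (bl_abs x).
Proof. by have [] := (bljoinP x (- x) (bl_abs x)).1 (ble_refl _). Qed.

Lemma bl_abs_ge0 x : ble 0 (bl_abs x).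
Proof.
have h : ble 0 (2 *: bl_abs x).
  rewrite scaler_nat mulr2n; apply: (@ble_trans _ _ (x + bl_abs x)).
    by have := ble_add2r x _ _ (bl_abs_geN x); rewrite addNr addrC.
  by apply: ble_add2r; exact: bl_abs_ge.
have i2 : 0 <= 2^-1 :> R by rewrite invr_ge0.
by have := ble_scale_ge0 i2 h; rewrite scalerA mulVf// scale1r.
Qed.

Lemma ble_norm_abs x y : ble x y -> ble (- x) y -> `|x| <= `|y|.
Proof.
move=> xy Nxy; apply: ble_norm; apply: ble_trans (bl_abs_ge y).
by apply/bljoinP.
Qed.

Lemma ble_norm_ge0 x y : ble 0 x -> ble x y -> `|x| <= `|y|.
Proof.
move=> x0 xy; apply: ble_norm_abs => //; apply: ble_trans xy.
by apply/ble_subr_ge0; rewrite opprK; exact: ble_addr_ge0.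
Qed.

(** Both [x - y] and [y - x] lie below [x + y]. In [vm_normE] this shows that a Hahn decomposition
    cannot give a larger norm than the constant sign. *)
Lemma ble_normB x y : ble 0 x -> ble 0 y -> `|x - y| <= `|x + y|.
Proof.
move=> x0 y0; apply: ble_norm_abs.
  by apply/ble_subr_ge0; rewrite opprB addrC addrA subrK; exact: ble_addr_ge0.
by apply/ble_subr_ge0; rewrite opprK addrACA subrr addr0; exact: ble_addr_ge0.
Qed.

(* The vectors w - t u (w, t >= 0) form a cone on which the norm is at least
   t |u^-|; a functional above this bound is positive, and negative at u if
   u^- <> 0. *)
Lemma ble_dual_ge0 u :
  (forall phi : dual_space E, (forall x, ble 0 x -> 0 <= phi x) -> 0 <= phi u) ->
  ble 0 u.
Proof.
move=> h; pose un := bljoin (- u) 0.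
have [un1 un2] : ble (- u) un /\ ble 0 un by apply/bljoinP; exact: ble_refl.
pose C := [set c : E * R | exists w t,
  [/\ ble 0 w, 0 <= t & c = (w - t *: u, t * `|un|)]].
have [|phi [_ phiC]] := @mazur_orlicz _ _ C.
  split.
  - exists 0, 0; split; [exact: ble_refl|by []|].
    by rewrite scale0r mul0r subr0.
  - move=> _ _ _ _ [w [t [w0 t0 [-> ->]]]] [w' [t' [w'0 t'0 [-> ->]]]].
    exists (w + w'), (t + t'); split; [exact: ble_addr_ge0|exact: addr_ge0|].
    by rewrite scalerDl mulrDl opprD addrACA.
  - move=> r _ _ r0 [w [t [w0 t0 [-> ->]]]].
    exists (r *: w), (r * t); split; [exact: ble_scale_ge0|exact: mulr_ge0|].
    by rewrite scalerBr scalerA mulrA.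
  - move=> _ _ [w [t [w0 t0 [-> ->]]]].
    have [->|tn0] := eqVneq t 0; first by rewrite mul0r.
    rewrite -[X in X * _]ger0_norm// -normrZ; set z := w - _.
    suff : ble (t *: un) (bl_abs z).
      move=> le; apply: ble_norm; apply: ble_trans le; apply/bljoinP; split.
        exact: ble_refl.
      apply/ble_subr_ge0; rewrite opprK.
      by apply: ble_addr_ge0; exact: ble_scale_ge0.
    (* As [w >= 0], the vector [- t u] is below [z], hence below its modulus. So [t^-1 |z|]
       dominates both [- u] and 0, and therefore their join [un]. *)
    suff : ble un (t^-1 *: bl_abs z).
      by move=> /(ble_scale _ _ _ t0); rewrite scalerA divff// scale1r.
    have ti0 : 0 <= t^-1 by rewrite invr_ge0.
    apply/bljoinP; split; last by apply: ble_scale_ge0 => //; exact: bl_abs_ge0.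
    have : ble (- (t *: u)) (bl_abs z).
      apply: ble_trans (bl_abs_ge z).
      by apply/ble_subr_ge0; rewrite /z opprK subrK.
    by move=> /(ble_scale _ _ _ ti0); rewrite scalerN scalerA mulVf// scale1r.
have phi0 x : ble 0 x -> 0 <= phi x.
  move=> x0; apply: phiC; exists x, 0; split => //.
  by rewrite scale0r mul0r subr0.
have : `|un| <= phi (- u).
  apply: phiC; exists 0, 1; split => //; first exact: ble_refl.
  by rewrite scale1r mul1r sub0r.
rewrite linearN; have := h _ phi0; have := normr_ge0 un => a b c.
have /normr0_eq0 une : `|un| = 0 by lra.
by move: un1; rewrite une => /(ble_add2r u _ _); rewrite addNr add0r.
Qed.

(** The norms decrease, so if they do not tend to 0 they stay above some [e > 0]. The vectors above
    some [t *: v n] form a cone because [v] decreases, and there the norm is at least [t * e].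
    [mazur_orlicz] then gives [phi] with [phi (v n) >= e] for all [n], against weak nullity. *)
Lemma ble_nonincreasing_cvg0 (v : E^nat) :
  (forall n, ble 0 (v n)) -> (forall n, ble (v n.+1) (v n)) ->
  weakly_null v -> v n @[n --> \oo] --> (0 : E).
Proof.
move=> v0 vS wv.
have vle n m : (n <= m)%N -> ble (v m) (v n).
  move=> /subnKC <-; elim: (m - n)%N => [|k IH].
    by rewrite addn0; exact: ble_refl.
  by rewrite addnS; apply: ble_trans IH.
apply: contrapT => nv.
have [e e0 ve] : exists2 e : R, 0 < e & forall n, e <= `|v n|.
  apply: contrapT => ne; apply: nv; apply/cvgr0Pnorm_lt => e e0.
  have [n vn] : exists n, `|v n| < e.
    apply: contrapT => h; apply: ne; exists e => // n.
    by rewrite leNgt; apply/negP => vn; apply: h; exists n.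
  exists n => // m /= nm; apply: le_lt_trans vn; apply: ble_norm_ge0 => //.
  exact: vle.
pose C := [set c : E * R | exists t n,
  [/\ 0 <= t, ble (t *: v n) c.1 & c.2 = t * e]].
have [|phi [_ phiC]] := @mazur_orlicz _ _ C.
  split.
  - by exists 0, 0%N; rewrite /= scale0r mul0r; split => //; exact: ble_refl.
  - move=> w s w' s' [t [n [/= t0 wn ->]]] [t' [n' [/= t'0 wn' ->]]].
    exists (t + t'), (maxn n n'); split => /=; last by rewrite mulrDl.
      exact: addr_ge0.
    rewrite scalerDl; apply: (@ble_trans _ _ (w + t' *: v (maxn n n'))).
      apply: ble_add2r; apply: ble_trans wn; apply: ble_scale => //.
      by apply: vle; rewrite leq_maxl.
    rewrite addrC [X in ble _ X]addrC.
    apply: ble_add2r; apply: ble_trans wn'; apply: ble_scale => //.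
    by apply: vle; rewrite leq_maxr.
  - move=> r w s r0 [t [n [/= t0 wn ->]]].
    exists (r * t), n; split => /=; [exact: mulr_ge0| |by rewrite mulrA].
    by rewrite -scalerA; exact: ble_scale.
  - move=> w s [t [n [/= t0 wn ->]]].
    apply: (@le_trans _ _ `|t *: v n|).
      by rewrite normrZ ger0_norm// ler_wpM2l.
    by apply: ble_norm_ge0 => //; exact: ble_scale_ge0.
have phiv n : e <= phi (v n).
  apply: phiC; exists 1, n; rewrite /= scale1r mul1r.
  by split => //; exact: ble_refl.
have /cvgr0Pnorm_lt/(_ _ e0)[N _ /(_ N (leqnn N))] := wv phi.
by rewrite ltNge (le_trans (phiv N))// ler_norm.
Qed.

End banach_lattice.

(** * Non-atomic finite measures *)

Section finite_measure_real.
Context d (T : measurableType d) (R : realType).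
Variable mu : {finite_measure set T -> \bar R}.
Implicit Types A B C : set T.

Definition fmu A : R := fine (mu A).

Lemma fmuK A : measurable A -> (fmu A)%:E = mu A.
Proof. by move=> mA; rewrite fineK// fin_num_measure. Qed.

Lemma fmu_ge0 A : 0 <= fmu A.
Proof. exact: fine_ge0. Qed.

Lemma fmu0 : fmu set0 = 0.
Proof. by rewrite /fmu measure0. Qed.

Lemma fmuU A B : measurable A -> measurable B -> A `&` B = set0 ->
  fmu (A `|` B) = fmu A + fmu B.
Proof.
by move=> mA mB AB; rewrite /fmu measureU// fineD// fin_num_measure.
Qed.

Lemma fmuDI A B : measurable A -> measurable B ->
  fmu A = fmu (A `\` B) + fmu (A `&` B).
Proof.
move=> mA mB; rewrite -fmuU; last 3 first.
- exact: measurableD.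
- exact: measurableI.
- by apply/seteqP; split => // x [[_ nBx] [_ /nBx]].
by rewrite setUC setUIDK.
Qed.

Lemma le_fmu A B : measurable A -> measurable B -> A `<=` B -> fmu A <= fmu B.
Proof.
move=> mA mB AB; rewrite -lee_fin !fmuK//.
by apply: le_measure; rewrite ?inE.
Qed.

(** The positive form of non-atomicity for a finite measure. *)
Definition divisible := forall A, measurable A -> 0 < fmu A ->
  exists B, [/\ measurable B, B `<=` A, 0 < fmu B & 0 < fmu (A `\` B)].

Hypothesis mu_div : divisible.

(** The lighter piece of a splitting has at most half the measure; repeating this [n] times, with
    [fmu A <= e * 2 ^+ n], goes below [e]. *)
Lemma divisible_small A (e : R) : measurable A -> 0 < fmu A -> 0 < e ->
  exists B, [/\ measurable B, B `<=` A, 0 < fmu B & fmu B <= e].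
Proof.
move=> mA A0 e0.
have [n ne] : exists n : nat, fmu A <= e * 2 ^+ n.
  have := truncnS_gt (fmu A / e); set n := (Num.truncn _).+1 => ne.
  exists n; rewrite -ler_pdivrMl// mulrC (le_trans (ltW ne))//.
  by rewrite -natrX ler_nat ltnW// ltn_expl.
elim: n A mA A0 ne => [|n IH] A mA A0 ne.
  by exists A; split => //; rewrite expr0 mulr1 in ne.
have [B [mB BA B0 AB0]] := mu_div mA A0.
have mAB : measurable (A `\` B) by exact: measurableD.
have ABE : fmu A = fmu (A `\` B) + fmu B.
  by rewrite (fmuDI mA mB) (setIidr BA).
have [BAB|ABB] := leP (fmu B) (fmu (A `\` B)).
- have [|C [mC CB C0 Ce]] := IH B mB B0; first by move: ne; rewrite exprS; lra.
  by exists C; split => //; exact: subset_trans BA.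
- have [|C [mC CB C0 Ce]] := IH _ mAB AB0.
    by move: ne; rewrite exprS; lra.
  by exists C; split => //; apply: subset_trans CB _; exact: subDsetl.
Qed.

(* Sierpinski: exhaust B greedily, each time adding a set of measure at least
   half of the largest admissible one. *)
Lemma divisible_half B : measurable B ->
  exists A, [/\ measurable A, A `<=` B & fmu A = fmu B / 2].
Proof.
move=> mB; pose t := fmu B / 2; have t0 : 0 <= t by rewrite divr_ge0 ?fmu_ge0.
pose cand X C := [/\ measurable C, C `<=` B `\` X & fmu X + fmu C <= t].
pose ok X := [/\ measurable X, X `<=` B & fmu X <= t].
(* [next X] is disjoint from [X], keeps the total below [t], and has at least half the supremum of
   the measures of such sets. If that supremum is 0, or if [X] is not [ok], the empty set is
   taken. *)
have /choice[next nextP] : forall X, exists C, ok X ->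
    cand X C /\ forall C', cand X C' -> fmu C' <= 2 * fmu C.
  move=> X; have [okX|nok] := pselect (ok X); last by exists set0.
  pose S := [set fmu C | C in cand X]; have [mX XB Xt] := okX.
  have c0 : cand X set0 by split; rewrite ?fmu0 ?addr0.
  have hS : has_sup S.
    split; first by exists (fmu set0), set0.
    exists t => _ [C [mC _ XC] <-]; have := fmu_ge0 X; lra.
  have leS C : cand X C -> fmu C <= sup S.
    by move=> cC; apply: ub_le_sup; [case: hS|exists C].
  have := leS _ c0; rewrite fmu0 le_eqVlt => /predU1P[S0|S0].
    exists set0 => _; split => // C' /leS; rewrite -S0 fmu0 mulr0.
    exact.
  have S2 : 0 < sup S / 2 by rewrite divr_gt0.
  have [_ [C cC <-] CS] := sup_adherent S2 hS.
  exists C => _; split => // C' /leS; lra.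
pose X n := iter n (fun X => X `|` next X) set0.
have Xok n : ok (X n).
  elim: n => [|n IH]; first by rewrite /X/=; split; rewrite ?fmu0//; exact: sub0set.
  have [[mC CB Ct] _] := nextP _ IH; have [mX XB Xt] := IH.
  split; [exact: measurableU| |].
    by move=> x [/XB//|/CB[]].
  rewrite fmuU//; apply/seteqP; split => // x [Xx /CB[_]]; exact.
have XS n : fmu (X n.+1) = fmu (X n) + fmu (next (X n)).
  have [mX _ _] := Xok n; have [[mC CB _] _] := nextP _ (Xok n).
  by rewrite [LHS]fmuU//; apply/seteqP; split => // x [Xx /CB[_]]; exact.
have mX n : measurable (X n) by have [] := Xok n.
have mbX : measurable (\bigcup_n X n) by exact: bigcup_measurable.
have ndX : {homo X : n m / (n <= m)%N >-> (n <= m)%O}.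
  by apply/nondecreasing_seqP => n; apply/subsetPset => x Xx; left.
have bXB : \bigcup_n X n `<=` B.
  by move=> x [n _ Xx]; have [_ XB _] := Xok n; exact: XB.
have bXt : fmu (\bigcup_n X n) <= t.
  rewrite -lee_fin fmuK//.
  have h := @nondecreasing_cvg_mu _ _ _ mu X mX mbX ndX.
  rewrite -(cvg_lim _ h)//; apply: lime_le; first exact: cvgP h.
  by apply: nearW => n /=; rewrite -fmuK// lee_fin; have [] := Xok n.
exists (\bigcup_n X n); split => //.
apply/eqP; rewrite eq_le bXt leNgt; apply/negP => lt_t.
set U := \bigcup_n X n in bXt lt_t mbX bXB.
have BU : fmu B = fmu (B `\` U) + fmu U.
  by rewrite (fmuDI mB mbX) (setIidr bXB).
have Bt : fmu B = 2 * t by rewrite /t; lra.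
(* If the union [U] falls short of [t], a set [D] of positive measure fits into the gap. It is a
   candidate at every stage, so each stage adds at least [fmu D / 2], and the measures of the [X n]
   exceed [t]. *)
have [|||D [mD DB D0 Dt]] := @divisible_small (B `\` U) (t - fmu U).
- exact: measurableD.
- lra.
- by rewrite subr_gt0.
have Dn n : n%:R * fmu D <= 2 * fmu (X n).
  elim: n => [|n IH]; first by rewrite mul0r mulr_ge0 ?fmu_ge0.
  have [_ h] := nextP _ (Xok n); have : cand (X n) D.
    split => //.
      by move=> x /DB[Bx nUx]; split => // Xx; apply: nUx; exists n.
    have : fmu (X n) <= fmu U by apply: le_fmu => // x Xx; exists n.
    lra.
  by move=> /h; rewrite XS -natr1 mulrDl mul1r; lra.
have := truncnS_gt (2 * t / fmu D); set n := (Num.truncn _).+1.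
rewrite ltr_pdivrMr// => h; have := Dn n; have [_ _] := Xok n; lra.
Qed.

(* Splitting B along the sets of s one at a time keeps the halving exact on all
   of them. *)
Lemma divisible_half_seq (s : seq (set T)) B :
  measurable B -> (forall S, S \in s -> measurable S) ->
  exists A, [/\ measurable A, A `<=` B, fmu A = fmu B / 2 &
    forall S, S \in s -> fmu (A `&` S) = fmu (B `&` S) / 2].
Proof.
elim: s B => [|S s IH] B mB ms.
  by have [A [mA AB AE]] := divisible_half mB; exists A.
have mS : measurable S by apply: ms; rewrite inE eqxx.
have {}ms S' : S' \in s -> measurable S' by move=> S's; apply: ms; rewrite inE S's orbT.
have [A [mA AB AE As]] := IH _ (measurableI _ _ mB mS) ms.
have [A' [mA' AB' AE' As']] := IH _ (measurableD mB mS) ms.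
have d0 : A `&` A' = set0.
  by apply/seteqP; split => // x [/AB[_ Sx] /AB'[_]]; exact.
exists (A `|` A'); split.
- exact: measurableU.
- by move=> x [/AB[]|/AB'[]].
- rewrite fmuU// AE AE' (fmuDI mB mS); lra.
- move=> S'; rewrite inE => /predU1P[->|S's].
    rewrite setIUl.
    rewrite (_ : A' `&` S = set0) ?setU0; last first.
      by apply/seteqP; split => // x [/AB'[_ nSx]].
    by rewrite (setIidl _) ?AE// => x /AB[].
  have mS' := ms _ S's.
  rewrite setIUl fmuU ?As ?As'//; last 3 first.
  - exact: measurableI.
  - exact: measurableI.
  - by rewrite setIACA d0 set0I.
  rewrite (fmuDI (measurableI _ _ mB mS') mS) setIAC (_ : _ `\` S = (B `\` S) `&` S').
    by lra.
  by rewrite !setDE setIAC.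
Qed.

(** [L n] lists the sets chosen before stage [n], and the new set halves the whole space and each
    set of [L n]. Only pairwise independence results, which is all that orthogonality needs. *)
Lemma divisible_half_independent : exists A : (set T)^nat,
  [/\ forall n, measurable (A n),
      forall n, fmu (A n) = fmu setT / 2 &
      forall k n, (k < n)%N -> fmu (A k `&` A n) = fmu setT / 4].
Proof.
have /choice[f fP] : forall s : seq (set T), exists A,
    (forall S, S \in s -> measurable S) ->
    [/\ measurable A, fmu A = fmu setT / 2 &
      forall S, S \in s -> fmu (A `&` S) = fmu S / 2].
  move=> s; have [ms|nms] := pselect (forall S, S \in s -> measurable S); last first.
    by exists set0.
  have [A [mA _ AE As]] := divisible_half_seq measurableT ms.
  by exists A => _; split => // S /As; rewrite setTI.
pose L n := iter n (fun s => f s :: s) [::].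
have mL n S : S \in L n -> measurable S.
  elim: n S => [|n IH] S //=; rewrite inE => /predU1P[->|/IH//].
  by have [] := fP _ IH.
have LL k n : (k < n)%N -> f (L k) \in L n.
  elim: n => // n IH; rewrite ltnS leq_eqVlt => /predU1P[->|/IH h].
    by rewrite /= inE eqxx.
  by rewrite /= inE h orbT.
exists (fun n => f (L n)); split.
- by move=> n; have [] := fP _ (@mL n).
- by move=> n; have [] := fP _ (@mL n).
- move=> k n kn; rewrite setIC; have [_ _ ->] := fP _ (@mL n).
    by have [_ -> _] := fP _ (@mL k); lra.
  exact: LL.
Qed.

End finite_measure_real.

(** * Rademacher-like functions and Bessel's inequality *)

Section bessel.
Context d (T : measurableType d) (R : realType).
Variable mu : {finite_measure set T -> \bar R}.
Implicit Types (A B C : set T) (f g h : T -> R).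

(** A class closed under sums and products and integrable for the finite measure [mu], so that the
    Hilbert space computations below need no further integrability conditions. *)
Definition bounded_measurable f :=
  measurable_fun setT f /\ exists K, forall x, `|f x| <= K.
Local Notation bm := bounded_measurable.

Lemma bounded_measurable_indic A : measurable A -> bm \1_A.
Proof.
move=> mA; split; first exact: measurable_indic.
exists 1 => x; rewrite indicE; case: (x \in A); rewrite ?normr1//= normr0 ?ler01//.
Qed.

Lemma bounded_measurableD f g : bm f -> bm g -> bm (f \+ g).
Proof.
move=> [mf [K fK]] [mg [L gL]]; split; first exact: measurable_funD.
by exists (K + L) => x; rewrite (le_trans (ler_normD _ _))// lerD.
Qed.

Lemma bounded_measurableM f g : bm f -> bm g -> bm (f \* g).
Proof.
move=> [mf [K fK]] [mg [L gL]]; split; first exact: measurable_funM.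
by exists (K * L) => x; rewrite normrM ler_pM.
Qed.

Lemma bounded_measurable_cst (r : R) : bm (fun=> r).
Proof. by split => //; exists `|r|. Qed.

Lemma bounded_measurable_integrable f : bm f -> mu.-integrable setT (EFin \o f).
Proof.
move=> [mf [K fK]]; apply: measurable_bounded_integrable => //.
  by rewrite -ge0_fin_numE// fin_num_measure.
exists K; split; first exact: num_real.
by move=> M KM x _; exact: le_trans (fK x) (ltW KM).
Qed.

Local Notation J f := (\int[mu]_x f x).

Lemma RintegralD_bm f g : bm f -> bm g -> J (f \+ g) = J f + J g.
Proof.
by move=> /bounded_measurable_integrable fi /bounded_measurable_integrable gi;
  rewrite RintegralD.
Qed.

Lemma RintegralZ_bm (r : R) f : bm f -> J (fun x => r * f x) = r * J f.
Proof. by move=> /bounded_measurable_integrable fi; rewrite RintegralZl. Qed.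

Lemma Rintegral_indic A : measurable A -> J \1_A = fmu mu A.
Proof. by move=> mA; rewrite /Rintegral integral_indic// setIT. Qed.

Definition rademacher A x : R := 2 * \1_A x - 1.

Lemma rademacherM A x : rademacher A x * rademacher A x = 1.
Proof. by rewrite /rademacher indicE; case: (x \in A) => /=; ring. Qed.

Lemma rademacher_norm A x : `|rademacher A x| = 1.
Proof.
rewrite /rademacher indicE; case: (x \in A) => /=.
  by rewrite mulr1 (_ : 2 - 1 = 1) ?normr1//; ring.
by rewrite mulr0 sub0r normrN1.
Qed.

Lemma bounded_measurable_rademacher A : measurable A -> bm (rademacher A).
Proof.
move=> mA; apply: (@bounded_measurableD (fun x => 2 * \1_A x) (fun=> -1)).
  apply: (@bounded_measurableM (fun=> 2)); first exact: bounded_measurable_cst.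
  exact: bounded_measurable_indic.
exact: bounded_measurable_cst.
Qed.

Variable A : (set T)^nat.
Hypothesis mA : forall n, measurable (A n).
Hypothesis A2 : forall n, fmu mu (A n) = fmu mu setT / 2.
Hypothesis A4 : forall k n, (k < n)%N -> fmu mu (A k `&` A n) = fmu mu setT / 4.
Local Notation r n := (rademacher (A n)).
Local Notation M := (fmu mu setT).

Let bmr n : bm (r n).
Proof. exact: bounded_measurable_rademacher. Qed.

(** The product expands into [4 * \1_(A k & A n) - 2 * \1_(A k) - 2 * \1_(A n) + 1], with [&] for
    intersection; its integral is [M - M - M + M]. *)
Let rr k n : (k < n)%N -> J (r k \* r n) = 0.
Proof.
move=> kn; have mAA : measurable (A k `&` A n) by exact: measurableI.
have bi B : measurable B -> forall a : R, bm (fun x => a * \1_B x).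
  move=> mB a; apply: (@bounded_measurableM (fun=> a)).
    exact: bounded_measurable_cst.
  exact: bounded_measurable_indic.
transitivity (J (((fun x => 4 * \1_(A k `&` A n) x) \+
    (fun x => - 2 * \1_(A k) x)) \+ ((fun x => - 2 * \1_(A n) x) \+ (fun=> 1)))).
  apply: eq_Rintegral => x _; rewrite /= /rademacher !indicE in_setI.
  by case: (x \in A k); case: (x \in A n) => /=; ring.
rewrite RintegralD_bm; last 2 first.
- by apply: bounded_measurableD; exact: bi.
- by apply: bounded_measurableD; [exact: bi|exact: bounded_measurable_cst].
rewrite RintegralD_bm; [|exact: bi..].
rewrite RintegralD_bm; [|exact: bi|exact: bounded_measurable_cst].
rewrite !RintegralZ_bm ?Rintegral_indic//; [|exact: bounded_measurable_indic..].
by rewrite Rintegral_cst// A2 A2 A4// -/(fmu mu setT); lra.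
Qed.

(* g N = h - (1/M) sum_(k < N) c k * r k satisfies J (g N * r n) = c n for
   n >= N, so J (g N ^+ 2) - J (g N.+1 ^+ 2) = c N ^+ 2 / M telescopes. *)
Lemma rademacher_bessel h : bm h -> 0 < M ->
  J (h \* r n) @[n --> \oo] --> (0 : R).
Proof.
move=> bh M0; pose c n := J (h \* r n).
pose g := fix g n : T -> R := if n is m.+1
  then g m \+ (fun x => - (c m / M) * r m x) else h.
have bc (a : R) f : bm f -> bm (fun x => a * f x).
  move=> bf; apply: (@bounded_measurableM (fun=> a)) => //.
  exact: bounded_measurable_cst.
have bg n : bm (g n).
  by elim: n => //= n IH; apply: bounded_measurableD => //; exact: bc.
have gr N n : (N <= n)%N -> J (g N \* r n) = c n.
  elim: N => //= N IH Nn.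
  transitivity (J ((g N \* r n) \+ (fun x => - (c N / M) * (r N \* r n) x))).
    by apply: eq_Rintegral => x _ /=; ring.
  have bM := @bounded_measurableM.
  rewrite RintegralD_bm; [|exact: bM|by apply: bc; exact: bM].
  by rewrite RintegralZ_bm ?rr ?mulr0 ?addr0 ?IH//; [exact: ltnW|exact: bM].
pose I n := J (g n \* g n).
have IS n : I n.+1 = I n - c n ^+ 2 / M.
  rewrite /I; set a := c n / M.
  transitivity (J ((g n \* g n) \+ ((fun x => (- 2 * a) * (g n \* r n) x) \+
      (fun=> a ^+ 2)))).
    apply: eq_Rintegral => x _ /=; rewrite -/a.
    have := rademacherM (A n) x; set y := rademacher _ _ => yy.
    transitivity (g n x * g n x + (- 2 * a * (g n x * y)) + a ^+ 2 * (y * y)).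
      by ring.
    by rewrite yy; ring.
  have bM := @bounded_measurableM.
  have bgr : bm (fun x => - 2 * a * (g n \* r n) x) by apply: bc; exact: bM.
  rewrite RintegralD_bm; last 2 first.
  - exact: bM.
  - by apply: bounded_measurableD => //; exact: bounded_measurable_cst.
  rewrite RintegralD_bm//; last exact: bounded_measurable_cst.
  rewrite RintegralZ_bm ?gr//; last exact: bM.
  rewrite Rintegral_cst// -/(fmu mu setT) /a; congr (_ + _).
  by field; exact: lt0r_neq0.
have I0 n : 0 <= I n by apply: Rintegral_ge0 => x _ /=; rewrite -expr2 sqr_ge0.
have cI : cvgn I.
  apply: nonincreasing_is_cvgn.
    apply/nonincreasing_seqP => n; rewrite IS lerBlDr lerDl.
    by rewrite divr_ge0 ?sqr_ge0// ltW.
  by exists 0 => _ [n _ <-].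
have c2 : c n ^+ 2 @[n --> \oo] --> (0 : R).
  rewrite (_ : (fun n => _) = (fun n => M * (I n - I n.+1))); last first.
    by apply/funext => n; rewrite IS; field; exact: lt0r_neq0.
  rewrite -[X in _ --> X](mulr0 M) -(subrr (limn I)).
  apply: cvgMr; apply: cvgB => //; rewrite (cvg_shiftS I) //.
apply/cvgr0Pnorm_lt => e e0.
have e2 : 0 < e ^+ 2 by rewrite exprn_gt0.
have /cvgr0Pnorm_lt/(_ _ e2) := c2; apply: filterS => n.
rewrite normrX ltr_pXn2r// ?nnegrE//; exact: ltW.
Qed.

(** Bessel's inequality divides by the total mass; if that mass is 0, all the integrals vanish. *)
Lemma rademacher_bounded_cvg h : bm h ->
  J (h \* r n) @[n --> \oo] --> (0 : R).
Proof.
move=> bh; have := fmu_ge0 mu setT; rewrite le_eqVlt => /predU1P[M0|]; last first.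
  exact: rademacher_bessel.
have muT0 : mu setT = 0%E by rewrite -(fmuK mu measurableT) -M0.
rewrite (_ : (fun n => _) = fun=> 0); first exact: cvg_cst.
apply/funext => n; rewrite /Rintegral null_set_integral//.
  apply/measurable_EFinP; have [//] := bounded_measurableM bh (bmr n).
Qed.

(** Simple functions approximate [h] in mean, and since the functions [r n] have modulus 1 the error
    is at most the integral of [|h - g k|], uniformly in [n]. *)
Lemma rademacher_cvg0 h : mu.-integrable setT (EFin \o h) ->
  J (h \* r n) @[n --> \oo] --> (0 : R).
Proof.
move=> hi.
have integrableM_r f n : mu.-integrable setT (EFin \o f) ->
    mu.-integrable setT (EFin \o (f \* r n)).
  move=> fi; have /measurable_EFinP mf := measurable_int _ fi.
  apply: (le_integrable measurableT _ _ fi).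
    apply/measurable_EFinP/measurable_funM => //; have [//] := bmr n.
  by move=> x _ /=; rewrite normrM rademacher_norm mulr1.
have [g [gi _ gh]] := approximation_sfun_integrable measurableT hi.
have bg k : bm (g k).
  split => //; have [K [Kr gK]] := simple_bounded (g k).
  exists (`|K| + 1) => x; apply: gK => //.
  by rewrite (le_lt_trans (ler_norm K))// ltrDl.
apply/cvgr0Pnorm_lt => e e0.
have e2 : 0 < e / 2 by rewrite divr_gt0.
have [k ke] : exists k, \int[mu]_x `|h x - g k x| < e / 2.
  have /fine_cvgP[_ /cvgr0Pnorm_lt/(_ _ e2)[k _ /(_ k (leqnn k)) /= ke]] := gh.
  by exists k; exact: le_lt_trans (ler_norm _) ke.
have hgi : mu.-integrable setT (EFin \o (fun x => h x - g k x)).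
  exact: (integrableB measurableT hi (gi k)).
have /cvgr0Pnorm_lt/(_ _ e2) := rademacher_bounded_cvg (bg k).
apply: filterS => n gn.
have -> : J (h \* r n) = J (g k \* r n) + J ((fun x => h x - g k x) \* r n).
  rewrite -RintegralD//; [|exact: integrableM_r..].
  by apply: eq_Rintegral => x _ /=; ring.
rewrite (le_lt_trans (ler_normD _ _))// (splitr e) ltrD//.
apply: le_lt_trans ke; apply: le_trans (le_normr_Rintegral measurableT _) _.
  exact: integrableM_r.
rewrite le_eqVlt; apply/orP; left; apply/eqP; apply: eq_Rintegral => x _ /=.
by rewrite normrM rademacher_norm mulr1.
Qed.

End bessel.

(** * Control measure of a vector measure with relatively compact range *)

Section weak_compactness.
Context (R : realType) (E : normedModType R).

(** Otherwise infinitely many terms stay at distance at least [e] from [l], and by compactness these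
    have a cluster point [p]. A functional norming [p - l] shows that weak convergence forces
    [p = l], which is impossible at that distance. *)
Lemma compact_weak_cvg (K : set E) (x : E^nat) (l : E) : compact K ->
  (forall n, K (x n)) ->
  (forall phi : dual_space E, phi (x n) @[n --> \oo] --> phi l) ->
  x n @[n --> \oo] --> l.
Proof.
move=> cK Kx xl; apply: contrapT => nxl.
have [e e0 fr] : exists2 e : R, 0 < e &
    ~ \forall n \near \oo, `|l - x n| < e.
  apply: contrapT => h; apply: nxl; apply/cvgrPdist_lt => e e0.
  by apply: contrapT => nh; apply: h; exists e.
pose S := [set n | e <= `|l - x n|].
(* Since [S] is unbounded, restricting [\oo] to it is a proper filter; it takes the place of a
   subsequence. *)
have pS : ProperFilter (within S \oo).
  apply: Build_ProperFilter_ex => P [N _ NP]; apply: contrapT => nP; apply: fr.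
  exists N => // n Nn; rewrite ltNge; apply/negP => Sn; apply: nP.
  by exists n; exact: NP.
have [|p [Kp clp]] := cK (x @ within S \oo) (fmap_proper_filter x pS).
  by apply: nearW => n _; exact: Kx.
have pl : p = l.
  have [phi [phip phin]] := hahn_banach (p - l).
  apply/eqP; rewrite -subr_eq0 -normr_eq0 -phip;
    rewrite -normr_le0 phip normr_id leNgt; apply/negP => pl0.
  have p20 : 0 < `|p - l| / 2 by rewrite divr_gt0.
  have [] := clp [set v | `|phi l - phi v| < `|p - l| / 2]
                 [set v | `|p - v| < `|p - l| / 2].
  - have /cvgrPdist_lt/(_ _ p20) := xl phi.
    by apply: filterS => n h _.
  - apply/nbhs_ballP; exists (`|p - l| / 2) => //= v; rewrite -ball_normE//.
  - move=> v [/= h1 h2].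
    have := phin (p - v); have := ler_normD (phi p - phi v) (phi v - phi l).
    rewrite subrKA -!linearB phip normr_id; move: h1.
    by rewrite distrC -linearB; lra.
have [] := clp [set v | e <= `|l - v|] [set v | `|p - v| < e].
- exact: nearW.
- by apply/nbhs_ballP; exists e => //= v; rewrite -ball_normE.
- by move=> v [/=]; rewrite pl ltNge => ->.
Qed.

(** Each [Kn n], the part of [K] where the norm is at least [1/(n+1)], is compact and is covered by
    the open sets on which a norming functional of one of its points does not vanish. Finitely many
    functionals suffice for each [n], and every nonzero vector of [K] lies in some [Kn n]. *)
Lemma compact_separating_sequence (K : set E) : compact K ->
  exists psi : nat -> dual_space E, (forall n, dual_unit_ball (psi n)) /\
    forall v, K v -> (forall n, psi n v = 0) -> v = 0.
Proof.
move=> cK; have /choice[phi phiP] := @hahn_banach R E.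
pose Kn n := K `&` [set v | n.+1%:R^-1 <= `|v|].
have cKn n : compact (Kn n).
  apply: compact_closedI => //.
  rewrite (_ : [set v | _] = (fun v : E => `|v|) @^-1` [set t | n.+1%:R^-1 <= t])//.
  by apply: closed_comp => [v _|]; [exact: norm_continuous|exact: closed_ge].
have /choice[D DP] : forall n, exists D : {fset E},
    Kn n `<=` cover [set` D] (fun v => [set w | phi v w != 0]).
  move=> n; have := cKn n; rewrite compact_cover.
  move=> /(_ E (Kn n) (fun v => [set w | phi v w != 0])) [||D _ KD].
  - move=> v _.
    rewrite (_ : [set w | _] = phi v @^-1` [set t | t != 0])//.
    by apply: open_comp => [w _|]; [exact: dual_continuous|exact: open_neq].
  - move=> v Kv; exists v => //=; have [-> _] := phiP v.
    have [_ h] := Kv; rewrite normr_eq0 -normr_eq0 gt_eqF//.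
    by apply: lt_le_trans h; rewrite invr_gt0.
  - by exists D.
(* The pairs [(n, i)] are enumerated through their codes. The default values, [phi 0] and the 0 of
   [nth], also give functionals in the dual unit ball. *)
pose psi k := if (choice.unpickle k : option (nat * nat)) is Some (n, i)
  then phi (nth 0 (D n) i) else phi 0.
exists psi; split.
  move=> k; apply/dual_unit_ballP => x; rewrite /psi.
  case: (choice.unpickle k : option (nat * nat)) => [[n i]|].
    by have [_] := phiP (nth 0 (D n) i).
  by have [_] := phiP 0.
move=> v Kv psiv; apply/eqP; rewrite -normr_eq0; apply/negPn/negP => v0.
have {}v0 : 0 < `|v| by rewrite lt_def v0 /=.
pose n := Num.truncn (`|v|^-1).
have [|w /= Dw] := DP n v.
  split => //=; rewrite -[leRHS]invrK lef_pV2 ?posrE ?invr_gt0//.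
  exact/ltW/truncnS_gt.
have := psiv (choice.pickle (n, index w (D n))).
by rewrite /psi choice.pickleK nth_index// => ->; rewrite eqxx.
Qed.

End weak_compactness.

Section indicators.
Context d (T : measurableType d) (R : realType).
Implicit Types (mu : {charge set T -> \bar R}) (A B : set T).

Lemma charge_integrable_indic mu B : measurable B ->
  charge_integrable mu (\1_B : T -> R).
Proof.
move=> mB; apply/(variation_integrable _ _ measurableT); split.
  exact: (@integrable_indic _ _ _ (jordan_pos (hahnP mu)) _ mB).
exact: (@integrable_indic _ _ _ (jordan_neg (hahnP mu)) _ mB).
Qed.

Lemma charge_integral_indic mu A B : measurable A -> measurable B ->
  charge_integral mu A \1_B = fine (mu (A `&` B)).
Proof.
move=> mA mB; have mAB : measurable (A `&` B) by exact: measurableI.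
have [[mP _] [mN _] PNT PN0] := hahnP mu.
rewrite /charge_integral /Rintegral !integral_indic// (setIC B A).
rewrite -[X in fine X - _]/(pos_part mu (A `&` B)).
rewrite -[X in _ - fine X]/(neg_part mu (A `&` B)) pos_partE// neg_partE//.
have mP' : measurable (A `&` B `&` hahn_pos mu) by exact: measurableI.
have mN' : measurable (A `&` B `&` hahn_neg mu) by exact: measurableI.
rewrite fineN opprK -fineD; [|exact: fin_num_measure..]; congr (fine _).
have disj : A `&` B `&` hahn_pos mu `&` (A `&` B `&` hahn_neg mu) = set0.
  by rewrite setIACA PN0 setI0.
by rewrite -[in RHS](setIT (A `&` B)) -PNT setIUr (chargeU mu mP' mN' disj).
Qed.

Context (E : normedModType R).
Implicit Types nu : vector_measure T E.

Lemma vm_integrable_indic nu B : measurable B -> vm_integrable nu (\1_B : T -> R).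
Proof.
move=> mB; split; first exact: measurable_indic.
  by move=> phi; exact: charge_integrable_indic.
by move=> A mA; exists (nu (A `&` B)) => phi; rewrite charge_integral_indic.
Qed.

(** A bound on the total variations uniform over the dual ball, which makes the series defining the
    control measure finite. *)
Lemma variation_le_vm_norm nu (phi : dual_space E) : dual_unit_ball phi ->
  (Defs.variation (scalar_measure nu phi) setT <= vm_norm nu \1_setT)%E.
Proof.
move=> bphi; apply: ereal_sup_ubound; exists phi => //.
rewrite -[X in _ = Defs.variation _ X]setIT -integral_indic//.
by apply: eq_integral => x _; rewrite ger0_norm.
Qed.

End indicators.

Section finite_measure_of.
Context d (T : measurableType d) (R : realType).
Variables (m : {measure set T -> \bar R}) (mfin : fin_num_fun m).

(** The proof of finiteness is an argument so that the finite measure instance below can find it in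
    the term. *)
Definition finite_measure_of (_ : fin_num_fun m) : set T -> \bar R := m.

HB.instance Definition _ := Measure.on (finite_measure_of mfin).
HB.instance Definition _ := Measure_isFinite.Build d T R
  (finite_measure_of mfin) mfin.

End finite_measure_of.

Section control_measure.
Context d (T : measurableType d) (R : realType) (E : normedModType R).
Variable nu : vector_measure T E.

(** The measure is the sum of the variations of [psi k \o nu] with weights [2^-(k+1)]. If it
    vanishes on [A], every [psi k] kills [nu B] for [B] inside [A], and the [psi k] separate the
    range from 0. *)
Lemma exists_control_measure : compact (closure (vm_range nu)) ->
  exists mu : {finite_measure set T -> \bar R},
    forall A, measurable A -> mu A = 0%E <-> vm_null nu A.
Proof.
move=> cK; have [psi [psi1 psi0]] := compact_separating_sequence cK.
have w0 k : 0 <= ((2 ^ k.+1)%:R^-1 : R) by rewrite invr_ge0.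
pose m k : {measure set T -> \bar R} :=
  mscale (NngNum (w0 k)) (Defs.variation (scalar_measure nu (psi k))).
have mE k A : m k A = ((2 ^ k.+1)%:R^-1%:E *
    Defs.variation (scalar_measure nu (psi k)) A)%E by [].
pose mu0 : {measure set T -> \bar R} := mseries m 0.
have Mfin : vm_norm nu \1_setT \is a fin_num.
  exact/vm_norm_fin/vm_integrable_indic.
set M := vm_norm nu \1_setT in Mfin.
have M0 : 0 <= fine M by rewrite fine_ge0// vm_norm_ge0.
have mu0T : (mu0 setT <= (fine M)%:E)%E.
  apply: le_trans (epsilon_trick0 xpredT M0); apply: lee_nneseries => //.
  move=> k _; rewrite mE mulrC EFinM fineK//.
  by apply: lee_wpmul2l; rewrite ?lee_fin//; exact: variation_le_vm_norm.
have mufin : fin_num_fun mu0.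
  move=> A mA; rewrite ge0_fin_numE//; apply: le_lt_trans (ltry (fine M)).
  by apply: le_trans mu0T; apply: le_measure; rewrite ?inE.
exists (finite_measure_of mufin) => A mA.
change (mu0 A = 0%E <-> vm_null nu A); split=> [A0|nA]; last first.
  apply: eseries0 => k _ _.
  by rewrite mE vm_null_variation// mule0.
have vA0 k : Defs.variation (scalar_measure nu (psi k)) A = 0%E.
  have : m k A = 0%E.
    apply/eqP; rewrite eq_le measure_ge0 andbT -A0.
    have -> : mu0 A = (\sum_(0 <= j <oo) m j A)%E by [].
    rewrite (@nneseriesD1 _ _ k)//.
    by rewrite leeDl// nneseries_ge0.
  move/eqP; rewrite mE mule_eq0 => /orP[|/eqP//].
  by rewrite eqe invr_eq0 pnatr_eq0 expn_eq0.
split=> // B mB BA; apply: psi0.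
  by apply: subset_closure; exists B.
move=> k; have : (`|scalar_measure nu (psi k) B| <= 0)%E.
  rewrite -(vA0 k); apply: (le_trans (abse_charge_variation (hahnP _) mB)).
  by apply: le_measure; rewrite ?inE.
by rewrite lee_fin normr_le0 => /eqP.
Qed.

Lemma non_atomic_divisible (mu : {finite_measure set T -> \bar R}) :
  (forall A, measurable A -> mu A = 0%E <-> vm_null nu A) ->
  non_atomic nu -> divisible mu.
Proof.
move=> muP na A mA A0.
have gt0 B : measurable B -> ~ vm_null nu B -> 0 < fmu mu B.
  move=> mB nB; rewrite lt_def fmu_ge0 andbT; apply/eqP => B0; apply: nB.
  by apply/muP => //; rewrite -fmuK// B0.
apply: contrapT => nB; apply: (na A); split => //.
  by move=> /muP A00; move: A0; rewrite /fmu A00//= ltxx.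
move=> B mB BA; have [|nB0] := pselect (vm_null nu B); first by left.
right; apply: contrapT => nAB; apply: nB; exists B; split => //.
  exact: gt0.
by apply: gt0 => //; exact: measurableD.
Qed.

(* For a charge m with density h with respect to the control measure, the
   sequence below is the integral of h 1_B r_n. *)
Lemma exists_rademacher_sequence :
  compact (closure (vm_range nu)) -> non_atomic nu ->
  exists A : (set T)^nat, (forall n, measurable (A n)) /\
    forall (m : {charge set T -> \bar R}) (B : set T), measurable B ->
      (forall Z, vm_null nu Z -> m Z = 0%E) ->
      2 * fine (m (B `&` A n)) - fine (m B) @[n --> \oo] --> (0 : R).
Proof.
move=> cK na; have [mu muP] := exists_control_measure cK.
have [A [mA A2 A4]] := divisible_half_independent (non_atomic_divisible muP na).
exists A; split => // m B mB mZ.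
have mmu : m `<< mu.
  by apply/null_content_dominatesP => Z mZ' /muP nZ; apply: mZ; exact: nZ.
pose f := Radon_Nikodym m mu.
have ff x : f x \is a fin_num by exact: Radon_Nikodym_fin_num.
have fi : mu.-integrable setT f by exact: Radon_Nikodym_integrable.
pose h := (fine \o f) \_ B.
have hE C : measurable C ->
    mu.-integrable setT (EFin \o ((fine \o f) \_ C)) /\
    fine (m C) = \int[mu]_x ((fine \o f) \_ C) x.
  move=> mC; have e : EFin \o ((fine \o f) \_ C) = f \_ C.
    by apply/funext => x; rewrite /= !patchE; case: ifP => //= _; rewrite fineK.
  rewrite e; split.
    by apply/(integrable_mkcond _ mC).1; apply: (integrableS measurableT) fi.
  rewrite (Radon_Nikodym_integral mmu mC) integral_mkcond /Rintegral.
  by congr fine; apply: eq_integral => x _; rewrite -e.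
have [hi hB] := hE B mB.
rewrite (_ : (fun n => _) = fun n => \int[mu]_x (h \* rademacher R (A n)) x).
  exact: rademacher_cvg0 hi.
apply/funext => n; have mBA : measurable (B `&` A n) by exact: measurableI.
have [hBAi ->] := hE _ mBA; rewrite hB -RintegralZl// -RintegralB//; last first.
  have := integrableZl measurableT 2 hBAi.
  by apply: eq_integrable => // x _; rewrite /= EFinM.
apply: eq_Rintegral => x _; rewrite /h /rademacher /= indicE !patchE in_setI.
(* [point] is the value of a restricted function off its set. *)
have p0 : point = 0 :> R by [].
by case: (x \in B); case: (x \in A n) => /=; rewrite ?p0; ring.
Qed.

End control_measure.

(** * Integration with respect to a vector measure *)

Section vector_integral.
Context d (T : measurableType d) (R : realType) (E : normedModType R).
Variable nu : vector_measure T E.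
Implicit Types (f g : T -> R) (A B : set T) (phi : dual_space E).

(** Packing an integrable function lets the submodule structure of [L1fun nu] supply the closure
    properties below. *)
Lemma L1fun_of f : vm_integrable nu f -> exists F : L1fun nu, F = f :> (T -> R).
Proof.
move=> fi; have [mf _ _] := fi; pose f' := mfun_Sub (mem_set mf).
have f'E : f' = f :> (T -> R) by exact: mfun_valP.
have f'i : f' \in vm_integrable_pred nu by apply/asboolP; rewrite f'E.
by exists (MkL1fun f'i).
Qed.

Lemma L1fun_vm_integrable (F : L1fun nu) : vm_integrable nu F.
Proof. by have /asboolP := L1fun_integrable F. Qed.

Lemma vm_integrableD f g : vm_integrable nu f -> vm_integrable nu g ->
  vm_integrable nu (f \+ g).
Proof.
by move=> /L1fun_of[F <-] /L1fun_of[G <-]; exact: (L1fun_vm_integrable (F + G)).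
Qed.

Lemma vm_integrableZ (r : R) f : vm_integrable nu f ->
  vm_integrable nu (fun x => r * f x).
Proof. by move=> /L1fun_of[F <-]; exact: (L1fun_vm_integrable (r *: F)). Qed.

Lemma vm_integrableB f g : vm_integrable nu f -> vm_integrable nu g ->
  vm_integrable nu (f \- g).
Proof.
by move=> /L1fun_of[F <-] /L1fun_of[G <-]; exact: (L1fun_vm_integrable (F - G)).
Qed.

Lemma charge_integralM_indic (mu : {charge set T -> \bar R}) A B f :
  charge_integral mu A (f \* \1_B) = charge_integral mu (A `&` B) f.
Proof.
rewrite /charge_integral; congr (_ - _); rewrite Rintegral_mkcondr;
  apply: eq_Rintegral => x _; rewrite /= indicE patchE;
  by case: ifP => _; rewrite ?mulr1 ?mulr0.
Qed.

Lemma vm_integrableM_indic B f : measurable B -> vm_integrable nu f ->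
  vm_integrable nu (f \* \1_B).
Proof.
move=> mB [mf fi fv]; have mfB : measurable_fun setT (f \* \1_B).
  by apply: measurable_funM => //; exact: measurable_indic.
split => //.
- move=> phi; apply: (le_integrable measurableT _ _ (fi phi)).
    exact/measurable_EFinP.
  move=> x _; rewrite /= lee_fin normrM ler_piMr// indicE.
  by case: (x \in B); rewrite ?normr1 ?normr0.
- move=> A mA; have [v vP] := fv _ (measurableI _ _ mA mB).
  by exists v => phi; rewrite charge_integralM_indic.
Qed.

Lemma vm_integrable_rademacher B f : measurable B -> vm_integrable nu f ->
  vm_integrable nu (f \* rademacher R B).
Proof.
move=> mB fi.
rewrite (_ : _ \* _ = (fun x => 2 * (f \* \1_B) x) \- f)%R; last first.
  by apply/funext => x; rewrite /rademacher/=; ring.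
by apply: vm_integrableB => //; apply: vm_integrableZ; exact: vm_integrableM_indic.
Qed.

Lemma measurable_nonneg f : measurable_fun setT f ->
  measurable [set x | 0 <= f x].
Proof.
move=> mf; rewrite (_ : [set x | _] = f @^-1` `[0, +oo[).
  by rewrite -[X in measurable X]setTI; exact: mf.
by apply/seteqP; split => x; rewrite /= in_itv/= andbT.
Qed.

(** The sign of [f] is itself of the form [rademacher], which reduces integrability of the absolute
    value to that of products with indicators. *)
Lemma normr_rademacher f x : `|f x| = f x * rademacher R [set y | 0 <= f y] x.
Proof.
rewrite /rademacher indicE.
have [fx|fx] := leP 0 (f x).
  by rewrite mem_set// mulr1 ger0_norm//; ring.
rewrite memNset; last by move=> /=; rewrite leNgt fx.
by rewrite ltr0_norm// mulr0; ring.
Qed.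

Lemma vm_integrable_norm f : vm_integrable nu f ->
  vm_integrable nu (fun x => `|f x|).
Proof.
move=> fi; have [mf _ _] := fi; under eq_fun do rewrite normr_rademacher.
by apply: vm_integrable_rademacher => //; exact: measurable_nonneg.
Qed.

(** The integral over the whole space, characterised by duality: for integrable [f] such a vector
    exists, and [dual_eq] makes it unique. Otherwise 0 may be a junk value. *)
Definition vint f : E := xget 0 [set v | forall phi,
  phi v = charge_integral (scalar_measure nu phi) setT f].

Lemma vintE f phi : vm_integrable nu f ->
  phi (vint f) = charge_integral (scalar_measure nu phi) setT f.
Proof.
move=> [_ _ /(_ _ measurableT)[v vP]]; rewrite /vint.
by case: xgetP => [_ _ ->//|/(_ v)].
Qed.

Lemma dual_eq (v w : E) : (forall phi, phi v = phi w) -> v = w.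
Proof.
move=> vw; apply/eqP; rewrite -subr_eq0; apply/eqP; apply: dual_sep => phi.
by rewrite linearB vw subrr.
Qed.

Lemma vintD f g : vm_integrable nu f -> vm_integrable nu g ->
  vint (f \+ g) = vint f + vint g.
Proof.
move=> fi gi; apply: dual_eq => phi.
rewrite linearD !vintE//; last exact: vm_integrableD.
have [_ fi' _] := fi; have [_ gi' _] := gi.
exact: (charge_integralD measurableT (fi' phi) (gi' phi)).
Qed.

Lemma vintZ (r : R) f : vm_integrable nu f ->
  vint (fun x => r * f x) = r *: vint f.
Proof.
move=> fi; apply: dual_eq => phi.
rewrite linearZ !vintE//; last exact: vm_integrableZ.
by have [_ fi' _] := fi; exact: (charge_integralZ r measurableT (fi' phi)).
Qed.

Lemma vintB f g : vm_integrable nu f -> vm_integrable nu g ->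
  vint (f \- g) = vint f - vint g.
Proof.
move=> fi gi; rewrite -scaleN1r -vintZ// -vintD//; last exact: vm_integrableZ.
by congr vint; apply/funext => x; rewrite /= mulN1r.
Qed.

Lemma vint_indic B : measurable B -> vint \1_B = nu B.
Proof.
move=> mB; apply: dual_eq => phi; rewrite vintE; last exact: vm_integrable_indic.
by rewrite charge_integral_indic// setTI.
Qed.

Lemma norm_vint_le f : vm_integrable nu f ->
  (`|vint f|%:E <= vm_norm nu f)%E.
Proof.
move=> fi; have [phi [phiv phi1]] := hahn_banach (vint f).
have bphi : dual_unit_ball phi by exact/dual_unit_ballP.
apply: (@le_trans _ _ (charge_norm (scalar_measure nu phi) f)); last first.
  by apply: ereal_sup_ubound; exists phi.
rewrite -(normr_id (vint f)) -phiv vintE//.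
by have [_ fi' _] := fi; exact: (charge_integral_le measurableT (fi' phi)).
Qed.

Lemma vm_norm_rademacher B f : vm_norm nu (f \* rademacher R B) = vm_norm nu f.
Proof.
rewrite /vm_norm; congr ereal_sup; apply/seteqP; split => _ [phi bphi <-];
  exists phi => //; apply: eq_integral => x _;
  by rewrite /= normrM rademacher_norm mulr1.
Qed.

Lemma vm_norm_abs f : vm_norm nu (fun x => `|f x|) = vm_norm nu f.
Proof.
rewrite /vm_norm; congr ereal_sup; apply/seteqP; split => _ [phi bphi <-];
  by exists phi => //; apply: eq_integral => x _; rewrite /= normr_id.
Qed.

(** Dominated convergence for the positive and the negative part of [phi \o nu], with [f] as
    dominating function. *)
Lemma vint_weakly_null f (g : (T -> R)^nat) : vm_integrable nu f ->
  (forall n, vm_integrable nu (g n)) ->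
  (forall n x, 0 <= g n x <= f x) ->
  (forall x, g n x @[n --> \oo] --> (0 : R)) ->
  weakly_null (fun n => vint (g n)).
Proof.
move=> fi gi gf g0 phi; have [mf fi' _] := fi.
have [fp fn] := charge_integrableS measurableT (fi' phi).
have key (m : {measure set T -> \bar R}) : m.-integrable setT (EFin \o f) ->
    \int[m]_x g n x @[n --> \oo] --> (0 : R).
  move=> mfi.
  have [||||_ _ h] := @dominated_convergence _ _ _ m setT measurableT
    (fun n => EFin \o g n) (cst 0%E) (EFin \o f) _ _ _ mfi _.
  - by move=> n; apply/measurable_EFinP; have [] := gi n.
  - exact: measurable_cst.
  - by apply: aeW => x _; apply: cvg_EFin; [exact: nearW|exact: g0].
  - apply: aeW => x n _; have /andP[g0' gfx] := gf n x.
    by rewrite /= lee_fin ger0_norm.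
  - by rewrite integral0 in h; exact: fine_cvg h.
rewrite -[X in _ --> X](subrr 0); under eq_fun do rewrite vintE//.
by apply: cvgB; exact: key.
Qed.

(** Total on raw functions, so that it can serve in the map [L] of [rademacher_density]; it is
    meaningful only for integrable [f]. *)
Definition L1of f : L1 nu := L1class (xget 0 [set F : L1fun nu | F = f :> (T -> R)]).

Lemma L1ofE f : vm_integrable nu f ->
  exists2 F : L1fun nu, F = f :> (T -> R) & L1of f = L1class F.
Proof.
move=> /L1fun_of[F FE]; rewrite /L1of; case: xgetP => [G _ GE|/(_ F)//].
by exists G.
Qed.

Lemma L1class_ext (F G : L1fun nu) : F =1 G -> L1class F = L1class G.
Proof.
move=> FG; apply/L1eqP; exists set0; last by move=> x _; exact: FG.
by split => // B mB; rewrite subset0 => ->; exact: vm0.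
Qed.

Lemma L1ofD f g : vm_integrable nu f -> vm_integrable nu g ->
  L1of (f \+ g) = L1of f + L1of g.
Proof.
move=> fi gi; have [F FE ->] := L1ofE fi; have [G GE ->] := L1ofE gi.
have [H HE ->] := L1ofE (vm_integrableD fi gi).
by rewrite -L1classD; apply: L1class_ext => x; rewrite HE -FE -GE.
Qed.

Lemma L1ofZ (r : R) f : vm_integrable nu f ->
  L1of (fun x => r * f x) = r *: L1of f.
Proof.
move=> fi; have [F FE ->] := L1ofE fi; have [G GE ->] := L1ofE (vm_integrableZ r fi).
by rewrite scale_L1class; apply: L1class_ext => x; rewrite GE -FE.
Qed.

Lemma norm_L1of f : vm_integrable nu f -> `|L1of f| = fine (vm_norm nu f).
Proof. by move=> fi; have [F <- ->] := L1ofE fi; exact: norm_L1class. Qed.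

Lemma L1of_surj (x : L1 nu) : exists2 f, vm_integrable nu f & x = L1of f.
Proof.
exists (L1repr x); first exact: L1fun_vm_integrable.
have [F FE ->] := L1ofE (L1fun_vm_integrable (L1repr x)).
by rewrite -[LHS]L1reprK; apply: L1class_ext => y; rewrite FE.
Qed.

End vector_integral.

(** * Positive vector measures *)

Section vector_measure_additive.
Context d (T : measurableType d) (R : realType) (E : normedModType R).
Variable nu : vector_measure T E.

Lemma vector_measureU A B : measurable A -> measurable B -> A `&` B = set0 ->
  nu (A `|` B) = nu A + nu B.
Proof.
move=> mA mB AB; apply: dual_eq => phi.
have := chargeU (scalar_measure nu phi) mA mB AB.
by rewrite linearD /= /scalar_measure -EFinD => -[].
Qed.

End vector_measure_additive.

Section positive_vector_measure.
Context d (T : measurableType d) (R : realType) (E : banachLatticeType R).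
Variable nu : vector_measure T E.
Hypothesis nu_pos : vm_range nu `<=` positive_cone E.
Implicit Types (f g : T -> R) (A B : set T) (phi : dual_space E).

Lemma charge_integral_ge0 (mu : {charge set T -> \bar R}) f :
  (forall A, measurable A -> (0 <= mu A)%E) -> measurable_fun setT f ->
  (forall x, 0 <= f x) -> 0 <= charge_integral mu setT f.
Proof.
move=> mu0 mf f0; have [_ [mN _] _ _] := hahnP mu.
have nT : neg_part mu setT = 0%E.
  apply/eqP; rewrite eq_le measure_ge0 andbT neg_partE//.
  by rewrite leeNl oppe0 mu0//; exact: measurableI.
rewrite /charge_integral [X in _ - X](_ : _ = 0).
  by rewrite subr0 Rintegral_ge0.
by rewrite /Rintegral null_set_integral//; exact/measurable_EFinP.
Qed.

(** Positivity is tested on positive functionals by [ble_dual_ge0], and for such [phi] the charge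
    [phi \o nu] is a positive measure. *)
Lemma vint_ge0 f : vm_integrable nu f -> (forall x, 0 <= f x) ->
  ble 0 (vint nu f).
Proof.
move=> fi f0; apply: ble_dual_ge0 => phi phi0.
have [mf _ _] := fi; rewrite vintE//; apply: charge_integral_ge0 => // A mA.
by rewrite lee_fin; apply: phi0; apply: nu_pos; exists A.
Qed.

(** Let [P], [N] be a Hahn decomposition for [phi \o nu], with [phi] in the dual ball. The integral
    of [|f|] against the variation is [phi (a - b)], where [a] and [b] are the vector integrals of
    [|f|] over [P] and [N]. As [a, b >= 0], it is at most [|a - b| <= |a + b|], and [a + b] is the
    integral of [|f|]. *)
Lemma vm_normE f : vm_integrable nu f ->
  vm_norm nu f = `|vint nu (fun x => `|f x|)|%:E.
Proof.
move=> fi; set g := fun x => `|f x|.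
have gi : vm_integrable nu g by exact: vm_integrable_norm.
apply/eqP; rewrite eq_le; apply/andP; split; last first.
  by rewrite -vm_norm_abs; exact: norm_vint_le.
apply: ge_ereal_sup => _ [phi /dual_unit_ballP phi1 <-].
set mu := scalar_measure nu phi; have [[mP _] [mN _] PNT PN0] := hahnP mu.
have [mg gint _] := gi; have gpn := charge_integrableS measurableT (gint phi).
have gPi := vm_integrableM_indic mP gi; have gNi := vm_integrableM_indic mN gi.
have gP0 : ble 0 (vint nu (g \* \1_(hahn_pos mu))).
  by apply: vint_ge0 => // x; rewrite /= /g indicE mulr_ge0.
have gN0 : ble 0 (vint nu (g \* \1_(hahn_neg mu))).
  by apply: vint_ge0 => // x; rewrite /= /g indicE mulr_ge0.
rewrite -/(charge_norm mu f).
have -> : charge_norm mu f = (phi (vint nu (g \* \1_(hahn_pos mu))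
    - vint nu (g \* \1_(hahn_neg mu))))%:E.
  rewrite linearB !vintE// !charge_integralM_indic.
  rewrite -(pos_part_integral measurableT (gint phi)).
  rewrite -[X in (_ - X)%:E]opprK -(neg_part_integral measurableT (gint phi)).
  rewrite opprK EFinD /charge_norm variation_integral//; last exact/measurable_EFinP.
  by case: gpn => gp gn; rewrite /Rintegral !fineK//; exact: integrable_fin_num.
rewrite lee_fin (le_trans (ler_norm _))// (le_trans (phi1 _))//.
rewrite (le_trans (ble_normB gP0 gN0))// -vintD//.
rewrite (_ : _ \+ _ = g)//; apply/funext => x; rewrite /= -mulrDr !indicE.
have : setT x by []. rewrite -PNT => -[Px|Nx].
  rewrite mem_set// memNset ?addr0 ?mulr1// => Nx.
  by have : (hahn_pos mu `&` hahn_neg mu) x by []; rewrite PN0.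
rewrite memNset ?add0r ?mem_set ?mulr1// => Px.
by have : (hahn_pos mu `&` hahn_neg mu) x by []; rewrite PN0.
Qed.

Import HBNNSimple.

(* Simple functions are dense: for 0 <= s_n increasing to f, the vectors
   vint (f - s_n) decrease and are weakly null, so they tend to 0 in norm. *)
Lemma vm_integrable_ind (Q : (T -> R) -> Prop) :
  (forall B, measurable B -> Q \1_B) ->
  (forall f g, vm_integrable nu f -> vm_integrable nu g -> Q f -> Q g ->
    Q (f \+ g)) ->
  (forall (r : R) f, vm_integrable nu f -> Q f -> Q (fun x => r * f x)) ->
  (forall f, vm_integrable nu f ->
    (forall e, 0 < e -> exists g, [/\ vm_integrable nu g, Q g &
      fine (vm_norm nu (f \- g)) < e]) -> Q f) ->
  forall f, vm_integrable nu f -> Q f.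
Proof.
move=> Q1 QD QZ Qlim.
have QQ0 : vm_integrable nu (0 : T -> R) /\ Q 0.
  have i0 : vm_integrable nu (\1_(@set0 T) : T -> R) by exact: vm_integrable_indic.
  suff <- : (\1_(@set0 T) : T -> R) = 0 by split => //; exact: Q1.
  by apply/funext => x; rewrite indicE in_set0.
have Qs (s : {nnsfun T >-> R}) : vm_integrable nu s /\ Q s.
  have [N [c [B [mB ->]]]] : exists N (c : 'I_N -> R) (B : 'I_N -> set T),
      (forall i, measurable (B i)) /\
      s = \sum_(i < N) (fun x => c i * \1_(B i) x) :> (T -> R).
    do 3 eexists; split; last first.
      by apply/funext => x; rewrite fct_sumE (fimfunEord s).
    by move=> i; exact: measurable_funPTI.
  elim/big_ind : _ => // [f g [fi Qf] [gi Qg]|i _].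
    by split; [exact: vm_integrableD|exact: QD].
  have iB : vm_integrable nu (\1_(B i) : T -> R) by exact: vm_integrable_indic.
  by split; [exact: vm_integrableZ|apply: QZ => //; exact: Q1].
have Qpos f : vm_integrable nu f -> (forall x, 0 <= f x) -> Q f.
  move=> fi f0; have [mf _ _] := fi.
  have /measurable_EFinP mf' := mf.
  pose s n : T -> R := nnsfun_approx measurableT mf' n.
  have si n : vm_integrable nu (s n) by have [] := Qs (nnsfun_approx measurableT mf' n).
  have Qsn n : Q (s n) by have [] := Qs (nnsfun_approx measurableT mf' n).
  have fs0 n x : 0 <= f x - s n x.
    rewrite subr_ge0 -lee_fin /s nnsfun_approxE.
    by apply: le_approx => // y _; rewrite lee_fin.
  have s0 n x : 0 <= s n x by exact: fun_ge0.
  have sS n x : s n x <= s n.+1 x.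
    by have /lefP := nd_nnsfun_approx measurableT mf' (leqnSn n); exact.
  have sf x : f x - s n x @[n --> \oo] --> (0 : R).
    rewrite -(subrr (f x)); apply: cvgB; first exact: cvg_cst.
    have /fine_cvgP[_] := @cvg_nnsfun_approx _ _ _ _ measurableT _ mf'
      (fun y _ => f0 y) x I.
    exact.
  have fsi n : vm_integrable nu (f \- s n) by exact: vm_integrableB.
  have v0 : vint nu (f \- s n) @[n --> \oo] --> (0 : E).
    apply: ble_nonincreasing_cvg0.
    - by move=> n; apply: vint_ge0 => // x; exact: fs0.
    - move=> n; apply/ble_subr_ge0; rewrite -vintB//; apply: vint_ge0.
        exact: vm_integrableB.
      by move=> x /=; have := sS n x; lra.
    - apply: (vint_weakly_null fi) => // n x /=; rewrite fs0/=.
      by have := s0 n x; lra.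
  apply: Qlim => // e e0; have /cvgr0Pnorm_lt/(_ _ e0)[n _ /(_ n (leqnn n))/= vn] := v0.
  exists (s n); split => //; rewrite vm_normE//=.
  rewrite (_ : (fun x => `|_|) = f \- s n)//.
  by apply/funext => x; rewrite /= ger0_norm.
move=> f fi; have [mf _ _] := fi; have mP := measurable_nonneg mf.
set P := [set x | _] in mP; have mN : measurable (~` P) by exact: measurableC.
have fPi := vm_integrableM_indic mP fi; have fNi := vm_integrableM_indic mN fi.
(* The decomposition into positive and negative parts, with the factor -1 written twice because [Q]
   is only known to be stable under sums and multiples. *)
rewrite (_ : f = (f \* \1_P) \+
    (fun x => -1 * (fun y => -1 * (f \* \1_(~` P)) y) x)); last first.
  apply/funext => x /=; rewrite !indicE in_setC.
  by case: (x \in P) => /=; ring.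
have fN'i := vm_integrableZ (-1) fNi.
apply: QD => //; first exact: vm_integrableZ.
  apply: Qpos => // x /=; rewrite indicE; case: (boolP (x \in P)) => /=.
    by rewrite inE /P/= mulr1.
  by rewrite mulr0.
apply: QZ => //; apply: Qpos => // x /=; rewrite indicE in_setC.
case: (boolP (x \in P)) => /=; first by rewrite !mulr0.
by rewrite notin_setE /P/= => /negP; rewrite -ltNge mulr1 mulN1r oppr_ge0 => /ltW.
Qed.

(* r_n-multiplication is isometric, so the convergence on indicators extends to
   the closed span. *)
Lemma rademacher_density (G : normedModType R) (L : (T -> R) -> G) (M : R)
    (A : (set T)^nat) :
  (forall n, measurable (A n)) ->
  (forall f g, vm_integrable nu f -> vm_integrable nu g ->
    L (f \+ g) = L f + L g) ->
  (forall (r : R) f, vm_integrable nu f -> L (fun x => r * f x) = r *: L f) ->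
  (forall f, vm_integrable nu f -> `|L f| <= M * fine (vm_norm nu f)) ->
  (forall B, measurable B -> 2 *: L \1_(B `&` A n) - L \1_B @[n --> \oo] --> (0 : G)) ->
  forall f, vm_integrable nu f ->
    L (f \* rademacher R (A n)) @[n --> \oo] --> (0 : G).
Proof.
move=> mA LD LZ LM L1.
have ri n f : vm_integrable nu f -> vm_integrable nu (f \* rademacher R (A n)).
  exact: vm_integrable_rademacher.
have LB f g : vm_integrable nu f -> vm_integrable nu g ->
    L (f \- g) = L f - L g.
  move=> fi gi; rewrite -scaleN1r -LZ// -LD//; last exact: vm_integrableZ.
  by congr L; apply/funext => x; rewrite /= mulN1r.
apply: vm_integrable_ind.
- move=> B mB; have mBA n : measurable (B `&` A n) by exact: measurableI.
  rewrite (_ : (fun n => _) = fun n => 2 *: L \1_(B `&` A n) - L \1_B); first exact: L1.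
  apply/funext => n; have iB := vm_integrable_indic nu mB.
  have iBA := vm_integrable_indic nu (mBA n).
  rewrite -LZ// -LB//; last exact: vm_integrableZ.
  congr L; apply/funext => x; rewrite /rademacher/= !indicE in_setI.
  by case: (x \in B); case: (x \in A n) => /=; ring.
- move=> f g fi gi fL gL; rewrite -(addr0 (0 : G)).
  rewrite (_ : (fun n => _) = fun n =>
    L (f \* rademacher R (A n)) + L (g \* rademacher R (A n))); first exact: cvgD.
  apply/funext => n; rewrite -LD; [|exact: ri..].
  by congr L; apply/funext => x; rewrite /= mulrDl.
- move=> r f fi fL; rewrite -(scaler0 G r).
  rewrite (_ : (fun n => _) = fun n => r *: L (f \* rademacher R (A n))).
    exact: cvgZr.
  apply/funext => n; rewrite -LZ; last exact: ri.
  by congr L; apply/funext => x; rewrite /= mulrA.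
- move=> f fi fapp; apply/cvgr0Pnorm_lt => e e0.
  pose M' := `|M| + 1; have M'0 : 0 < M' by rewrite ltr_wpDl.
  have [|g [gi gL ge]] := fapp (e / 2 / M'); first by rewrite !divr_gt0.
  have e2 : 0 < e / 2 by rewrite divr_gt0.
  have /cvgr0Pnorm_lt/(_ _ e2) := gL; apply: filterS => n gn.
  have fgi : vm_integrable nu (f \- g) by exact: vm_integrableB.
  have -> : L (f \* rademacher R (A n)) =
      L (g \* rademacher R (A n)) + L ((f \- g) \* rademacher R (A n)).
    rewrite -LD; [|exact: ri..].
    by congr L; apply/funext => x /=; ring.
  rewrite (le_lt_trans (ler_normD _ _))// (splitr e) ltrD//.
  apply: (le_lt_trans (LM _ (ri _ _ fgi))); rewrite vm_norm_rademacher.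
  move: ge; rewrite ltr_pdivlMr//; apply: le_lt_trans; rewrite mulrC ler_wpM2l//.
    by rewrite fine_ge0// vm_norm_ge0.
  by rewrite /M' (le_trans (ler_norm M))// lerDl.
Qed.

(** * The vector measure of indicator classes in [L1 nu] *)

Definition L1_indic A := L1of nu (\1_A : T -> R).

Let L1_indicU A B : measurable A -> measurable B -> A `&` B = set0 ->
  L1_indic (A `|` B) = L1_indic A + L1_indic B.
Proof.
move=> mA mB AB; rewrite /L1_indic -L1ofD; [|exact: vm_integrable_indic..].
congr L1of; apply/funext => x; rewrite /= !indicE in_setU.
have [xA|] := boolP (x \in A); have [xB|] := boolP (x \in B) => /=;
  rewrite ?addr0 ?add0r//.
have : (A `&` B) x by split; exact: set_mem.
by rewrite AB.
Qed.

Lemma norm_L1_indic A : measurable A -> `|L1_indic A| = `|nu A|.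
Proof.
move=> mA; have iA := vm_integrable_indic nu mA.
rewrite norm_L1of// vm_normE//= -(vint_indic nu mA).
by congr `|vint _ _|; apply/funext => x; rewrite ger0_norm.
Qed.

(** The remainder after [n] terms is the class of the indicator of the tail union [D n]. Its norm is
    that of [nu (D n)], the remainder of the series for [nu], which tends to 0. *)
Let L1_indic_sigma_additive (F : (set T)^nat) : (forall i, measurable (F i)) ->
  trivIset setT F ->
  series (fun i => L1_indic (F i)) @ \oo --> L1_indic (\bigcup_i F i).
Proof.
move=> mF tF; pose D n := \bigcup_(i in [set j | (n <= j)%N]) F i.
have mD n : measurable (D n) by apply: bigcup_measurable.
have tail (G : normedModType R) (N : set T -> G) :
    (forall A B, measurable A -> measurable B -> A `&` B = set0 ->
      N (A `|` B) = N A + N B) ->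
    forall n, N (\bigcup_i F i) = series (fun i => N (F i)) n + N (D n).
  move=> NU; elim=> [|n IH].
    rewrite /series/= big_geq// add0r; congr N; apply/seteqP.
    by split => x [i _ Fx]; exists i.
  rewrite IH /series/= big_nat_recr//= -addrA; congr (_ + _).
  rewrite -NU//; last first.
    apply/seteqP; split => // x [Fn [i /= ni Fi]].
    have /trivIsetP/(_ n i I I) := tF.
    rewrite ltn_eqF// => /(_ isT) Fni.
    by have : (F n `&` F i) x by []; rewrite Fni.
  congr N; apply/seteqP; split => [x [i /=]|x [Fn|[i /= ni Fi]]].
  - by rewrite leq_eqVlt => /predU1P[<-|ni] Fx; [left|right; exists i].
  - by exists n => /=.
  - by exists i => //=; exact: ltnW.
apply/cvgrPdist_lt => e e0.
have /cvgrPdist_lt/(_ _ e0) := vm_sigma_additive nu mF tF.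
apply: filterS => n.
rewrite (tail _ _ (@vector_measureU _ _ _ _ nu) n) (tail _ _ L1_indicU n).
have addBK (V : zmodType) (a b : V) : a + b - a = b by rewrite addrAC subrr add0r.
by rewrite !addBK norm_L1_indic.
Qed.

(** Composing it with a functional on [L1 nu] gives a scalar charge vanishing on [nu]-null sets, to
    which [exists_rademacher_sequence] applies. *)
Definition L1_indic_measure : vector_measure T (L1 nu) :=
  VectorMeasure L1_indic_sigma_additive.

Lemma L1_indic_measure_null Z : vm_null nu Z -> L1_indic_measure Z = 0.
Proof.
by move=> [mZ Z0]; apply/normr0_eq0; rewrite /= norm_L1_indic// Z0// normr0.
Qed.

(** * Weak almost squareness *)

Lemma positive_WASQ : compact (closure (vm_range nu)) -> non_atomic nu ->
  WASQ (L1 nu).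
Proof.
move=> cK na x x1; have [A [mA Ac]] := exists_rademacher_sequence cK na.
have [f fi xf] := L1of_surj x.
have ri n g : vm_integrable nu g -> vm_integrable nu (g \* rademacher R (A n)).
  exact: vm_integrable_rademacher.
have f1 : fine (vm_norm nu f) = 1 by rewrite -norm_L1of// -xf.
have y1 n : `|L1of nu (f \* rademacher R (A n))| = 1.
  by rewrite norm_L1of ?vm_norm_rademacher//; exact: ri.
have fini g : vm_integrable nu g -> vm_norm nu g \is a fin_num.
  exact: vm_norm_fin.
have vint0 g : vm_integrable nu g ->
    vint nu (g \* rademacher R (A n)) @[n --> \oo] --> (0 : E).
  apply: (@rademacher_density _ (vint nu) 1 A mA).
  - by move=> *; exact: vintD.
  - by move=> *; exact: vintZ.
  - by move=> h hi; rewrite mul1r -lee_fin fineK ?norm_vint_le//; exact: fini.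
  - move=> B mB; have mBA n : measurable (B `&` A n) by exact: measurableI.
    under eq_fun do rewrite !vint_indic//.
    rewrite -(subrr (nu B)); apply: cvgB; last exact: cvg_cst.
    (* It remains to see that [nu] of the intersection of [B] with [A n] tends to half of [nu B].
       The convergence is weak by the choice of [A], and in norm because these vectors lie in the
       compact closure of the range. *)
    rewrite [X in _ --> X](_ : _ = 2 *: (2^-1 *: nu B)); last first.
      by rewrite scalerA divff// scale1r.
    apply: cvgZr; apply: (compact_weak_cvg cK).
      by move=> n; apply: subset_closure; exists (B `&` A n).
    move=> phi; have := Ac (scalar_measure nu phi) B mB.
    have null0 Z : vm_null nu Z -> scalar_measure nu phi Z = 0%E.
      by move=> [mZ Z0]; rewrite /scalar_measure Z0// linear0.
    move=> /(_ null0) h; rewrite linearZ.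
    rewrite (_ : (fun n => _) = fun n =>
      2^-1 * (2 * phi (nu (B `&` A n)) - phi (nu B)) + 2^-1 * phi (nu B)); last first.
      by apply/funext => n; field.
    rewrite -[X in _ --> X]add0r -[X in X + _](mulr0 2^-1).
    by apply: cvgD; [exact: cvgMr|exact: cvg_cst].
have fa : vm_integrable nu (fun x => `|f x|) by exact: vm_integrable_norm.
(* Taking [c = 1] and [c = -1] handles both signs at once. *)
have pm (c : R) : `|c| = 1 ->
    `|x + c *: L1of nu (f \* rademacher R (A n))| @[n --> \oo] --> (1 : R).
  move=> c1; have c11 : -1 <= c <= 1 by rewrite -ler_norml c1.
  rewrite (_ : (fun n => _) = fun n => `|vint nu (fun x => `|f x|)
      + c *: vint nu ((fun x => `|f x|) \* rademacher R (A n))|).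
    rewrite -f1 vm_normE//=.
    apply: cvg_norm; rewrite -[X in _ --> X]addr0 -(scaler0 E c).
    by apply: cvgD; [exact: cvg_cst|apply: cvgZr; exact: vint0].
  apply/funext => n; rewrite xf -L1ofZ; last exact: ri.
  have ci := vm_integrableZ c (ri n _ fi).
  rewrite -L1ofD// norm_L1of; last exact: vm_integrableD.
  rewrite vm_normE; last exact: vm_integrableD.
  rewrite /= -vintZ; last exact: ri.
  rewrite -vintD//; last by apply: vm_integrableZ; exact: ri.
  congr `|vint _ _|; apply/funext => t /=.
  (* The factor [1 + c r] is nonnegative because [|c r| <= 1], so the absolute value falls on [f t]
     alone and the expression becomes linear in [r]. *)
  rewrite (_ : f t + _ = f t * (1 + c * rademacher R (A n) t)); last by ring.
  rewrite normrM (ger0_norm (x := 1 + _)); first by ring.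
  have : `|c * rademacher R (A n) t| <= 1 by rewrite normrM c1 rademacher_norm mulr1.
  by rewrite ler_norml => /andP[]; lra.
exists (fun n => L1of nu (f \* rademacher R (A n))); split.
(* Weak nullity: density reduces [phi] on [f r_n] to indicators, where the charge
   [phi \o L1_indic_measure] gives the limit. *)
- move=> phi; have [M M0 phiM] := dual_bounded phi.
  apply: (@rademacher_density _ (fun g => phi (L1of nu g) : R^o) M A mA) => //.
  - by move=> g h gi hi; rewrite L1ofD// linearD.
  - by move=> r g gi; rewrite L1ofZ// linearZ.
  - by move=> g gi; rewrite -norm_L1of.
  - move=> B mB; have := Ac (scalar_measure L1_indic_measure phi) B mB.
    apply => Z nZ.
    by rewrite /= /scalar_measure (L1_indic_measure_null nZ) linear0.
- by move=> n; rewrite y1.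
- under eq_fun do rewrite -[L1of nu _]scale1r; apply: pm; exact: normr1.
- under eq_fun do rewrite -scaleN1r; apply: pm; exact: normrN1.
- by under eq_fun do rewrite y1; exact: cvg_cst.
Qed.

End positive_vector_measure.

Theorem theorem1p1 (d : measure_display) (T : measurableType d) (R : realType)
    (E : banachLatticeType R) (nu : vector_measure T E)
    (nu_nonatomic : non_atomic nu)
    (nu_compact : compact (closure (vm_range nu)))
    (nu_pos : vm_range nu `<=` positive_cone E) :
  WASQ (L1 nu).
Proof. exact: positive_WASQ. Qed.
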